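(* Assume $\|X\|/p\le\lambda\le 2\bar\lambda$ with $\bar\lambda=2\|X\|\sqrt{\log p}$, and that there are constants $A_1,A_2,A_3,A_4>0$ (not depending on $p$) such that $A_1p^{-A_3}\pi_p(s-1)\le\pi_p(s)\le A_2p^{-A_4}\pi_p(s-1)$ for $s=1,\dots,p$. Then for every $M>2$, \[ \sup_{\beta^0\in\mathbb R^p}\mathbb E_{\beta^0}\Pi\Big(\beta:\ |S_\beta|>s_0+\frac{M}{A_4}\Big(1+\frac{16}{\phi(S_0)^2}\frac{\lambda}{\bar\lambda}\Big)s_0\ \Big|\ Y\Big)\to0 \] as $n,p\to\infty$, where $S_0=S_{\beta^0}$ and $s_0=|S_0|$.
   Context: Observations follow $Y=X\beta+\varepsilon$ with $X$ a deterministic real $n\times p$ matrix and $\varepsilon\sim N_n(0,I_n)$. For $\beta^0\in\mathbb R^p$, $\mathbb E_{\beta^0}$ denotes expectation when $Y\sim N_n(X\beta^0,I_n)$. For $\beta\in\mathbb R^p$, $S_\beta=\{i:\beta_i\neq0\}$; for $S\subset\{1,\dots,p\}$, $\beta_S=(\beta_i)_{i\in S}$ and $S^c$ is the complement. $X_{\cdot,i}$ is the $i$th column of $X$ and $\|X\|=\max_{i}\|X_{\cdot,i}\|_2$. The prior $\Pi$ on $\mathbb R^p$: draw $s$ from a probability $\pi_p$ on $\{0,\dots,p\}$, then $S$ uniformly among subsets of $\{1,\dots,p\}$ of size $s$, then $\beta_i$, $i\in S$, i.i.d. with Laplace density $x\mapsto\frac{\lambda}{2}e^{-\lambda|x|}$,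 and $\beta_i=0$ for $i\notin S$. The posterior is $\Pi(B\mid Y)=\int_Be^{-\|Y-X\beta\|_2^2/2}d\Pi(\beta)/\int e^{-\|Y-X\beta\|_2^2/2}d\Pi(\beta)$. The compatibility number of $S$ is $\phi(S)=\inf\{\|X\beta\|_2|S|^{1/2}/(\|X\|\,\|\beta_S\|_1):\ \beta\in\mathbb R^p,\ \|\beta_{S^c}\|_1\le7\|\beta_S\|_1,\ \beta_S\neq0\}$. Asymptotics: $n,p\to\infty$, with $X$, $\lambda$ and $\pi_p$ allowed to depend on $n,p$ subject to the stated assumptions (the constants $A_i$ are fixed). *)

(* Defs.v *)
From HB Require Import structures.
From mathcomp Require Import all_boot all_order all_algebra.
From mathcomp Require Import all_classical all_reals all_analysis.
Set Implicit Arguments. Unset Strict Implicit. Unset Printing Implicit Defensive.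
Import Order.TTheory GRing.Theory Num.Theory.
Import numFieldNormedType.Exports.
Local Open Scope classical_set_scope.
Local Open Scope ring_scope.

Section Defs.
Variable R : realType.

Definition upd k (b : 'I_k -> R) (i : 'I_k) (x : R) : 'I_k -> R :=
  fun j => if j == i then x else b j.

Fixpoint iint k (l : seq 'I_k) (f : ('I_k -> R) -> \bar R) (b : 'I_k -> R)
  : \bar R :=
  match l with
  | [::] => f b
  | i :: l' => (\int[@lebesgue_measure R]_x iint l' f (upd b i x))%E
  end.

Definition int_Rk k (f : ('I_k -> R) -> \bar R) : \bar R :=
  iint (enum 'I_k) f (fun _ => 0).

Definition int_RS p (S : {set 'I_p}) (f : ('I_p -> R) -> \bar R) : \bar R :=
  iint (enum S) f (fun _ => 0).

Definition mulXb n p (X : 'M[R]_(n, p)) (b : 'I_p -> R) : 'I_n -> R :=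
  fun i => \sum_(j < p) X i j * b j.

Definition sqnorm k (v : 'I_k -> R) : R := \sum_(i < k) v i ^+ 2.

Definition colnorm n p (X : 'M[R]_(n, p)) : R :=
  \big[Num.max/0]_(i < p) Num.sqrt (\sum_(j < n) X j i ^+ 2).

Definition lambar n p (X : 'M[R]_(n, p)) : R :=
  2 * colnorm X * Num.sqrt (ln (p%:R)).

Definition supp p (b : 'I_p -> R) : {set 'I_p} := [set i | b i != 0].

Definition l1on p (S : {set 'I_p}) (b : 'I_p -> R) : R :=
  \sum_(i in S) `|b i|.

Definition laplace (lam x : R) : R := lam / 2 * expR (- (lam * `|x|)).

Definition is_prob_on (p : nat) (pi : nat -> R) : Prop :=
  (forall s, (s <= p)%N -> 0 <= pi s) /\ \sum_(s < p.+1) pi s = 1.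

(* integral of f >= 0 against the spike-and-slab prior Pi *)
Definition prior_int p (pi : nat -> R) (lam : R) (f : ('I_p -> R) -> R)
  : \bar R :=
  (\sum_(S : {set 'I_p})
     (pi #|S| / ('C(p, #|S|))%:R)%:E *
     int_RS S (fun b => (f b * \prod_(i in S) laplace lam (b i))%:E))%E.

Definition lik n p (X : 'M[R]_(n, p)) (Y : 'I_n -> R) (b : 'I_p -> R) : R :=
  expR (- (sqnorm (fun i => Y i - mulXb X b i) / 2)).

Definition posterior n p (X : 'M[R]_(n, p)) (pi : nat -> R) (lam : R)
  (B : pred ('I_p -> R)) (Y : 'I_n -> R) : R :=
  fine (prior_int pi lam (fun b => if B b then lik X Y b else 0)) /
  fine (prior_int pi lam (lik X Y)).

Definition gauss_dens n p (X : 'M[R]_(n, p)) (b0 : 'I_p -> R) (y : 'I_n -> R)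
  : R :=
  powR (2 * pi) (- (n%:R / 2)) *
  expR (- (sqnorm (fun i => y i - mulXb X b0 i) / 2)).

Definition expect n p (X : 'M[R]_(n, p)) (b0 : 'I_p -> R)
  (g : ('I_n -> R) -> R) : \bar R :=
  int_Rk (fun y => (g y * gauss_dens X b0 y)%:E).

(* compatibility number phi(S), valued in \bar R (inf of the empty set,
   i.e. S = set0, is +oo) *)
Definition compat n p (X : 'M[R]_(n, p)) (S : {set 'I_p}) : \bar R :=
  ereal_inf [set (Num.sqrt (sqnorm (mulXb X b)) * Num.sqrt (#|S|%:R)
                  / (colnorm X * l1on S b))%:E
            | b in [set b : 'I_p -> R |
                     l1on (~: S) b <= 7 * l1on S b /\ exists2 i, i \in S & b i != 0]].

(* threshold s0 + M/A4 (1 + 16/phi^2 * lam/lambar) s0, with 16/phi^2 = +oo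
   when phi = 0 and 16/phi^2 = 0 when phi = +oo *)
Definition threshold (M A4 lam lb : R) (s0 : nat) (phi : \bar R) : \bar R :=
  match phi with
  | +oo%E => (s0%:R + M / A4 * s0%:R)%:E
  | r%:E => if r == 0 then (if s0 == 0%N then 0%E else +oo%E)
            else (s0%:R + M / A4 * (1 + 16 / r ^+ 2 * (lam / lb)) * s0%:R)%:E
  | -oo%E => (s0%:R + M / A4 * s0%:R)%:E
  end.

Definition dim_event (p : nat) (thr : \bar R) : pred ('I_p -> R) :=
  fun b => (thr < (#|supp b|%:R)%:E)%E.

End Defs.

(* Main.v *)
Require Import Defs.
From HB Require Import structures.
From mathcomp Require Import all_boot all_order all_algebra.
From mathcomp Require Import all_classical all_reals all_analysis.
From mathcomp Require Import measurable_realfun ring lra.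
Import Order.TTheory GRing.Theory Num.Theory.
Import numFieldNormedType.Exports.
Set Implicit Arguments. Unset Strict Implicit. Unset Printing Implicit Defensive.
Local Open Scope ring_scope.

(** With lb the universal threshold lambar X and d = beta - beta0, let G be
    the event that every column of X has inner product at most lb with the
    noise.  By a Chernoff bound G fails with probability at most 2/p.

    On G the marginal likelihood is at least, up to exp(O(sqrt(log p))),
    pi(s0) (e p^2)^(-s0) exp(-lam |beta0|_1) times the likelihood of beta0: it
    suffices to integrate over the box |d_i| <= 1/(lam p s0), i in S0.

    For the numerator put a = lam/(2 lb) <= 1 and split the score term
    <noise, X d> into a fraction a, bounded on G by (lam/2) |d|_1, and a
    fraction 1 - a, whose exponential moment is exp((1-a)^2 |X d|^2 / 2).  What
    is left of the quadratic term, at most -(lam/(4 lb)) |X d|^2, is played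
    against the l1 terms through the compatibility number; the outcome is
    p^((49/4) lam s0 / (lb phi^2)) exp(-(lam/4) |d|_1), and the last factor
    integrates to 4^s against (lam/2)^s over a slice of dimension s.

    The prior decay pi(s0 + k) <= (A2 p^(-A4))^k pi(s0) then beats the factor
    p^(2 s0 + (49/4) lam s0 / (lb phi^2)) as soon as
    k > (M/A4) (1 + 16 lam / (lb phi^2)) s0 with M > 2. *)

(** * Iterated integrals *)

Import HBNNSimple.

(* No measurability is needed: the integral is a supremum over simple functions. *)
Lemma ge0_le_integral_lower d (T : measurableType d) (R : realType)
    (mu : {measure set T -> \bar R}) (f g : T -> \bar R) :
  (forall x, 0 <= f x)%E -> (forall x, f x <= g x)%E ->
  (\int[mu]_x f x <= \int[mu]_x g x)%E.
Proof.
move=> f0 fg; have g0 x : (0 <= g x)%E by exact: le_trans (fg x).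
rewrite !ge0_integralTE//; apply: le_ereal_sup => _ [h hf <-].

by exists h => // x; exact: le_trans (fg x).
Qed.

Section IteratedIntegral.
Variable R : realType.
Local Notation leb := (@lebesgue_measure R).

Lemma upd_off k (b : 'I_k -> R) i x (l : seq 'I_k) (b' : 'I_k -> R) :
  (forall j, j \notin l -> b' j = upd b i x j) ->
  forall j, j \notin i :: l -> b' j = b j.
Proof.
move=> H j; rewrite inE negb_or => /andP[/negPf ji jl].
by rewrite H // /upd ji.
Qed.

(** The iterated integral only visits points that agree with [b] off [l], so the hypothesis is asked
    only there. On slices this gives access to the support of the parameter. *)
Lemma iint_ge0 k (l : seq 'I_k) (f : ('I_k -> R) -> \bar R) b :
  (forall b', (forall j, j \notin l -> b' j = b j) -> 0 <= f b')%E ->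
  (0 <= iint l f b)%E.
Proof.
elim: l b => [|i l IH] b H /=; first exact: H.
by apply: integral_ge0 => x _; apply: IH => b' Hb'; apply: H; exact: upd_off Hb'.
Qed.

Lemma iint_le k (l : seq 'I_k) (f g : ('I_k -> R) -> \bar R) b :
  (forall b', (forall j, j \notin l -> b' j = b j) -> 0 <= f b')%E ->
  (forall b', (forall j, j \notin l -> b' j = b j) -> f b' <= g b')%E ->
  (iint l f b <= iint l g b)%E.
Proof.
elim: l b => [|i l IH] b H0 H /=; first exact: H.
apply: ge0_le_integral_lower => x.
  by apply: iint_ge0 => b' Hb'; apply: H0; exact: upd_off Hb'.
by apply: IH => b' Hb'; [apply: H0|apply: H]; exact: upd_off Hb'.
Qed.

Lemma eq_iint k (l : seq 'I_k) (f g : ('I_k -> R) -> \bar R) b :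
  (forall b', (forall j, j \notin l -> b' j = b j) -> f b' = g b') ->
  iint l f b = iint l g b.
Proof.
elim: l b => [|i l IH] b H /=; first exact: H.
by apply: eq_integral => x _; apply: IH => b' Hb'; apply: H; exact: upd_off Hb'.
Qed.

Lemma iint0 k (l : seq 'I_k) (b : 'I_k -> R) : iint l (fun=> 0%E : \bar R) b = 0%E.
Proof. by elim: l b => [|i l IH] b //=; rewrite integral0_eq// => x _; exact: IH. Qed.

Definition coord_measurable d (T : measurableType d) k (g : T -> 'I_k -> R) :=
  forall i, measurable_fun setT (fun t => g t i).

(* Measurability is tested on all coordinatewise measurable families of points,
   so that no sigma-algebra on ['I_k -> R] is needed. *)
Definition jmeas k1 k2 (f : ('I_k1 -> R) -> ('I_k2 -> R) -> \bar R) :=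
  forall d (T : measurableType d) (g : T -> 'I_k1 -> R) (h : T -> 'I_k2 -> R),
    coord_measurable g -> coord_measurable h ->
    measurable_fun setT (fun t => f (g t) (h t)).

Definition meas k (f : ('I_k -> R) -> \bar R) :=
  forall d (T : measurableType d) (h : T -> 'I_k -> R),
    coord_measurable h -> measurable_fun setT (fun t => f (h t)).

Lemma coord_measurable_upd k (b : 'I_k -> R) i :
  coord_measurable (fun x : measurableTypeR R => upd b i x).
Proof. by move=> j; rewrite /upd; case: (j == i). Qed.

Lemma jmeas_swap k1 k2 (f : ('I_k1 -> R) -> ('I_k2 -> R) -> \bar R) :
  jmeas f -> jmeas (fun b y => f y b).
Proof. by move=> mf d T g h mg mh; exact: mf. Qed.

Lemma meas_jmeasr k1 k2 (f : ('I_k2 -> R) -> \bar R) :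
  meas f -> jmeas (fun (_ : 'I_k1 -> R) b => f b).
Proof. by move=> mf d T g h mg mh; exact: mf. Qed.

Lemma coord_measurable_cst d (T : measurableType d) k (b : 'I_k -> R) :
  coord_measurable (fun _ : T => b).
Proof. by move=> i; exact: measurable_cst. Qed.

Lemma jmeas_measr k1 k2 (f : ('I_k1 -> R) -> ('I_k2 -> R) -> \bar R) y :
  jmeas f -> meas (f y).
Proof.
by move=> mf d T h mh; apply: (mf _ _ (fun=> y) h) => //; exact: coord_measurable_cst.
Qed.

(** Induction on [l]: the integration variable joins the test space, [T] becoming a product of [T]
    with the line, and Tonelli's theorem gives measurability of the partial integral. Hence the
    quantification over all measurable spaces in [jmeas]. *)
Lemma jmeas_iint k1 k2 (f : ('I_k1 -> R) -> ('I_k2 -> R) -> \bar R) l :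
  (forall y b, 0 <= f y b)%E -> jmeas f -> jmeas (fun y b => iint l (f y) b).
Proof.
move=> f0 mf; elim: l => [|i l IH] //= d T g h mg mh.
pose F (tx : T * measurableTypeR R) := iint l (f (g tx.1)) (upd (h tx.1) i tx.2).
apply: (@measurable_fun_fubini_tonelli_F _ _ T (measurableTypeR R) R leb F).
- apply: (IH _ _ (fun tx : T * measurableTypeR R => g tx.1)
            (fun tx => upd (h tx.1) i tx.2)) => j.
    exact: measurableT_comp (mg j) measurable_fst.
  rewrite /upd; case: (j == i); first exact: measurable_snd.
  exact: measurableT_comp (mh j) measurable_fst.
- by move=> tx; apply: iint_ge0.
Qed.

Lemma meas_iint k (f : ('I_k -> R) -> \bar R) l :
  (forall b, 0 <= f b)%E -> meas f -> meas (iint l f).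
Proof.
move=> f0 mf; apply: (@jmeas_measr k k (fun _ => iint l f) (fun=> 0)).
by apply: (@jmeas_iint k k (fun _ => f)) => //; exact: meas_jmeasr.
Qed.

Lemma integral_iint k1 k2 (f : ('I_k1 -> R) -> ('I_k2 -> R) -> \bar R) y i m b :
  (forall y b, 0 <= f y b)%E -> jmeas f ->
  (\int[leb]_x iint m (f (upd y i x)) b =
   iint m (fun b => \int[leb]_x f (upd y i x) b) b)%E.
Proof.
move=> f0 mf; elim: m b => [|j m IH] b //=.
under [RHS]eq_integral do rewrite -IH.
pose F (xz : measurableTypeR R * measurableTypeR R) :=
  iint m (f (upd y i xz.1)) (upd b j xz.2).
apply: (@fubini_tonelli _ _ _ _ R leb leb F).
- apply: (@jmeas_iint _ _ f m f0 mf _ (measurableTypeR R * measurableTypeR R)%type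
     (fun xz => upd y i xz.1) (fun xz => upd b j xz.2)) => j'.
    exact: measurableT_comp (coord_measurable_upd y i j') measurable_fst.
  exact: measurableT_comp (coord_measurable_upd b j j') measurable_snd.
- by move=> xz; apply: iint_ge0.
Qed.

(** Tonelli for two blocks of variables, moved past each other one variable at a time. It exchanges
    the integral over the data with the one over the parameter. *)
Lemma iint_swap k1 k2 (f : ('I_k1 -> R) -> ('I_k2 -> R) -> \bar R) l m y b :
  (forall y b, 0 <= f y b)%E -> jmeas f ->
  (iint l (fun y => iint m (f y) b) y = iint m (fun b => iint l (f ^~ b) y) b)%E.
Proof.
move=> f0 mf; elim: l y => [|i l IH] y //=.
under eq_integral do rewrite IH.
apply: (@integral_iint _ _ (fun y b => iint l (f ^~ b) y)).
  by move=> *; apply: iint_ge0.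
by apply/jmeas_swap/(jmeas_iint (f := fun b y => f y b)) => //; exact: jmeas_swap.
Qed.

Lemma iint_sum k (I : Type) (r : seq I) (l : seq 'I_k)
    (f : I -> ('I_k -> R) -> \bar R) b :
  (forall s b, 0 <= f s b)%E -> (forall s, meas (f s)) ->
  (iint l (fun b => \sum_(s <- r) f s b) b = \sum_(s <- r) iint l (f s) b)%E.
Proof.
move=> f0 mf; elim: l b => [|i l IH] b //=.
under eq_integral do rewrite IH.
apply: (@ge0_integral_sum _ (measurableTypeR R) R leb setT measurableT I
  (fun s x => iint l (f s) (upd b i x))) => s.
  by apply: (@meas_iint _ _ l (f0 s) (mf s)); exact: coord_measurable_upd.
by move=> x _; apply: iint_ge0.
Qed.

Lemma iintD k (l : seq 'I_k) (f g : ('I_k -> R) -> \bar R) b :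
  (forall b, 0 <= f b)%E -> (forall b, 0 <= g b)%E -> meas f -> meas g ->
  (iint l (fun b => f b + g b) b = iint l f b + iint l g b)%E.
Proof.
move=> f0 g0 mf mg; elim: l b => [|i l IH] b //=.
under eq_integral do rewrite IH.
rewrite (@ge0_integralD _ (measurableTypeR R))//.
- by move=> x _; exact: iint_ge0.
- by apply: (@meas_iint _ _ l f0 mf); exact: coord_measurable_upd.
- by move=> x _; exact: iint_ge0.
- by apply: (@meas_iint _ _ l g0 mg); exact: coord_measurable_upd.
Qed.

Lemma iintZl k (l : seq 'I_k) (f : ('I_k -> R) -> \bar R) b (c : R) :
  0 <= c -> (forall b, 0 <= f b)%E -> meas f ->
  (iint l (fun b => c%:E * f b) b = c%:E * iint l f b)%E.
Proof.
move=> c0 f0 mf; elim: l b => [|i l IH] b //=.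
under eq_integral do rewrite IH.
rewrite (@ge0_integralZl _ (measurableTypeR R))//.
- by apply: (@meas_iint _ _ l f0 mf); exact: coord_measurable_upd.
- by move=> x _; exact: iint_ge0.
Qed.

Lemma meas_prod k (l : seq 'I_k) (F : 'I_k -> R -> R) :
  (forall i, measurable_fun setT (F i : measurableTypeR R -> measurableTypeR R)) ->
  meas (fun b => (\prod_(i <- l) F i (b i))%:E).
Proof.
move=> mF d T h mh; apply/measurable_EFinP.
by apply: measurable_prod => i _; exact: measurableT_comp (mF i) (mh i).
Qed.

Lemma iint_prod k (l : seq 'I_k) (F : 'I_k -> R -> R) (c : 'I_k -> R) b :
  uniq l -> (forall i x, 0 <= F i x) ->
  (forall i, measurable_fun setT (F i : measurableTypeR R -> measurableTypeR R)) ->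
  (forall i, i \in l -> (\int[leb]_x (F i x)%:E = (c i)%:E)%E) ->
  iint l (fun b => (\prod_(i <- l) F i (b i))%:E) b = (\prod_(i <- l) c i)%:E.
Proof.
move=> + F0 mF; elim: l b => [|i l IH] b /=; first by rewrite !big_nil.
move=> /andP[il ul] Fc.
have c0 : (0 <= (\prod_(j <- l) c j)%:E)%E.
  rewrite lee_fin big_seq; apply: prodr_ge0 => j jl.
  rewrite -lee_fin -Fc ?inE ?jl ?orbT//.
  by apply: integral_ge0 => x _; rewrite lee_fin.
transitivity (\int[leb]_x ((F i x)%:E * (\prod_(j <- l) c j)%:E))%E.
  apply: eq_integral => x _; rewrite -(IH (upd b i x)) //; last first.
    by move=> j jl; apply: Fc; rewrite inE jl orbT.
  rewrite -iintZl//; last 2 first.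
    by move=> b'; rewrite lee_fin; apply: prodr_ge0.
    exact: meas_prod.
  (* Uniqueness of the list enters here: the value given to coordinate [i] is not overwritten by the
     later integrations. *)
  by apply: eq_iint => b' Hb'; rewrite big_cons EFinM Hb' // /upd eqxx.
rewrite (@ge0_integralZr _ (measurableTypeR R))//.
- by rewrite Fc ?inE ?eqxx// big_cons EFinM.
- by apply/measurable_EFinP; exact: mF.
- by move=> x _; rewrite lee_fin.
Qed.

End IteratedIntegral.

(** * One-dimensional integrals and the Gaussian moment generating function *)

Section OneDim.
Variable R : realType.
Local Notation leb := (@lebesgue_measure R).

Lemma continuous_expRNabs (c : R) : continuous (fun x : R => expR (- (c * `|x|))).
Proof.
move=> x; apply: continuous_comp; last exact: continuous_expR.
apply: (@continuousN _ R^o); apply: (@continuousM _ R^o) => //.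
  exact: cst_continuous.
exact: norm_continuous.
Qed.

Lemma integral_shift (G : R -> R) (m : R) : continuous G -> (forall x, 0 <= G x) ->
  (\int[leb]_x (G (x - m))%:E = \int[leb]_x (G x)%:E)%E.
Proof.
move=> cG G0.
pose F (x : R^o) : R^o := x - m.
have F'E : F^`()%classic = cst 1.
  by apply/funext => x; rewrite /F derive1E deriveD// derive_id derive_cst addr0.
rewrite [RHS](@increasing_ge0_integration_by_substitutionT _ F) //.
- by apply: eq_integral => x _; rewrite F'E /= fctE /= mulr1.
- by move=> x y xy; rewrite /F ltrD2r.
- by rewrite F'E; move=> x; exact: cvg_cst.
- by rewrite F'E; exact: is_cvg_cst.
- by rewrite F'E; exact: is_cvg_cst.
- exact: cvg_addrr_Ny.
- exact: cvg_addrr.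
Qed.

(** Translation and symmetry reduce this to twice the mass of an exponential density, divided by
    [c]. *)
Lemma integral_expRNabs (c m : R) : 0 < c ->
  (\int[leb]_x (expR (- (c * `|x - m|)))%:E = (2 / c)%:E)%E.
Proof.
move=> c0; rewrite (@integral_shift (fun x => expR (- (c * `|x|)))) //; last first.
- exact: continuous_expRNabs.
rewrite ge0_symfun_integralT//; last 2 first.
- exact: continuous_expRNabs.
- by move=> x; rewrite /= normrN.
rewrite -set_itvcy integral_mkcond.
transitivity (2%:E * \int[leb]_x ((c^-1)%:E * (exponential_pdf c x)%:E))%E.
  congr (_ * _)%E; apply: eq_integral => x _.
  rewrite /exponential_pdf !patchE; case: ifPn => [|_]; last by rewrite mule0.
  rewrite inE/= in_itv/= andbT => x0.
  by rewrite -EFinM mulKf ?gt_eqF// ger0_norm// mulNr.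
rewrite ge0_integralZl//; last 3 first.
- by apply/measurable_EFinP; apply: measurable_exponential_pdf.
- by move=> x _; rewrite lee_fin exponential_pdf_ge0// ltW.
- by rewrite lee_fin invr_ge0 ltW.
by rewrite integral_exponential_pdf// mule1 -EFinM.
Qed.

(** Completing the square: the tilted density is [expR (u ^+ 2 / 2)] times the normal density
    centred at [m + u]. *)
Lemma integral_gauss_mgf (u m : R) :
  (\int[leb]_y (expR (u * (y - m)) *
     ((Num.sqrt (2 * pi))^-1 * expR (- ((y - m) ^+ 2 / 2))))%:E
   = (expR (u ^+ 2 / 2))%:E)%E.
Proof.
transitivity (\int[leb]_y ((expR (u ^+ 2 / 2))%:E * (normal_pdf (m + u) 1 y)%:E))%E.
  apply: eq_integral => y _; rewrite -EFinM; congr EFin.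
  rewrite normal_pdfE ?oner_eq0// /normal_peak /normal_fun expr1n mul1r.
  rewrite -(mulr_natl pi) [RHS]mulrCA [LHS]mulrCA -!expRD; congr (_ * expR _).
  lra.
rewrite ge0_integralZl//.
- by rewrite integral_normal_pdf mule1.
- by apply/measurable_EFinP; apply: measurable_normal_pdf.
- by move=> x _; rewrite lee_fin normal_pdf_ge0.
Qed.

Lemma measurable_gauss_tilted (u m : R) :
  measurable_fun setT ((fun y : R => expR (u * (y - m)) *
     ((Num.sqrt (2 * pi))^-1 * expR (- ((y - m) ^+ 2 / 2)))) :
     measurableTypeR R -> measurableTypeR R).
Proof.
apply: measurable_funM; first by apply: measurableT_comp => //; apply: measurable_funM => //; apply: measurable_funB.
apply: measurable_funM => //; apply: measurableT_comp => //.
apply: measurableT_comp => //; apply: measurable_funM => //.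
by apply: measurable_funX; apply: measurable_funB.
Qed.

Lemma gauss_densE n p (X : 'M[R]_(n, p)) b0 y :
  gauss_dens X b0 y =
  \prod_(i < n) ((Num.sqrt (2 * pi))^-1 * expR (- ((y i - mulXb X b0 i) ^+ 2 / 2))).
Proof.
rewrite /gauss_dens big_split /= prodr_const card_ord -expR_sum; congr (_ * _).
  have pi2 : 0 <= 2 * pi :> R by rewrite mulr_ge0 ?pi_ge0.
  rewrite powRN exprVn; congr (_^-1).
  by rewrite [n%:R / 2]mulrC powRrM powR12_sqrt// powR_mulrn ?sqrtr_ge0.
by rewrite /sqnorm mulr_suml sumrN.
Qed.

Lemma gauss_dens_ge0 n p (X : 'M[R]_(n, p)) b0 y : 0 <= gauss_dens X b0 y.
Proof. by rewrite mulr_ge0 ?powR_ge0 ?expR_ge0. Qed.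

(** The coordinates are independent, so the integral factors. It serves twice: to average the
    retained part of the score term over the data, and in the Chernoff bound. *)
Lemma gauss_mgf n p (X : 'M[R]_(n, p)) b0 (u : 'I_n -> R) :
  int_Rk (fun y => (expR (\sum_(i < n) u i * (y i - mulXb X b0 i))
                    * gauss_dens X b0 y)%:E)
  = (expR (sqnorm u / 2))%:E.
Proof.
transitivity (int_Rk (fun y : 'I_n -> R => (\prod_(i <- enum 'I_n)
  (expR (u i * (y i - mulXb X b0 i)) * ((Num.sqrt (2 * pi))^-1 *
     expR (- ((y i - mulXb X b0 i) ^+ 2 / 2)))))%:E)).
  apply: eq_iint => y _; congr EFin.
  by rewrite gauss_densE expR_sum -big_split /= big_enum.
rewrite /int_Rk (@iint_prod _ _ _ (fun i z => expR (u i * (z - mulXb X b0 i)) *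
   ((Num.sqrt (2 * pi))^-1 * expR (- ((z - mulXb X b0 i) ^+ 2 / 2))))
   (fun i => expR (u i ^+ 2 / 2))).
- by rewrite big_enum/= -expR_sum /sqnorm mulr_suml.
- exact: enum_uniq.
- by move=> i z; rewrite !mulr_ge0 ?expR_ge0 ?invr_ge0.
- by move=> i; exact: measurable_gauss_tilted.
- by move=> i _; exact: integral_gauss_mgf.
Qed.

End OneDim.

(** * Exponent arithmetic *)

Section Numeric.
Variable R : realType.

(** The inequality of arithmetic and geometric means, stated without square roots. *)
Lemma le_addr_of_sqr (x P Q : R) : 0 <= P -> 0 <= Q -> x ^+ 2 <= 4 * P * Q -> x <= P + Q.
Proof.
move=> P0 Q0 xPQ; have PQ0 : 0 <= P + Q by rewrite addr_ge0.
have [x0|x0] := leP x 0; first exact: le_trans x0 PQ0.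
rewrite -(@ler_pXn2r _ 2) ?nnegrE ?(ltW x0)//; apply: le_trans xPQ _.
have := sqr_ge0 (P - Q); nra.
Qed.

(** Here [A] and [C] stand for the l1 norms of [d] on and off the true support, [N] for $|Xd|_2^2$
    and [kap] for $\phi^{-2}$. What must be controlled is [7/4 lam A - 1/4 lam C]: outside the cone
    it is nonpositive, inside it the quadratic term absorbs [7/4 lam A]. *)
Lemma compat_exponent (lam lb Xn L kap s A C N : R) :
  0 < lam -> 0 < lb -> lb ^+ 2 = 4 * Xn ^+ 2 * L -> 0 <= L -> 0 <= kap -> 0 <= s ->
  0 <= A -> 0 <= C -> 0 <= N ->
  7 * A <= C \/ A ^+ 2 * Xn ^+ 2 <= kap * N * s ->
  3 / 2 * lam * A - 1 / 2 * lam * C - lam / (4 * lb) * N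
    <= - (lam / 4 * (A + C)) + 49 / 4 * (kap * (lam / lb)) * s * L.
Proof.
move=> lam0 lb0 lbE L0 kap0 s0 A0 C0 N0.
set t := lam / lb; have t0 : 0 < t by rewrite divr_gt0.
have -> : lam / (4 * lb) = t / 4.
  by rewrite /t; field; rewrite gt_eqF.
have Q0 : 0 <= kap * s * L by rewrite !mulr_ge0.
have tN : 0 <= t * N by rewrite mulr_ge0// ltW.
have tQ : 0 <= t * (kap * s * L) by rewrite mulr_ge0// ltW.
move=> [AC|AN].
  have : lam * (7 * A) <= lam * C by rewrite ler_pM2l.
  by nra.
have lamE : lam = t * lb by rewrite /t divfK// gt_eqF.
(* By compatibility the square of the left side is at most [49/4 kap N s L], which is four times the
   product of the two terms on the right. *)
have key : 7 / 4 * lb * A <= N / 4 + 49 / 4 * (kap * s * L).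
  apply: le_addr_of_sqr; [lra|lra|].
  have : 4 * L * (A ^+ 2 * Xn ^+ 2) <= 4 * L * (kap * N * s).
    by apply: ler_wpM2l => //; rewrite mulr_ge0.
  have -> : 4 * L * (A ^+ 2 * Xn ^+ 2) = (lb * A) ^+ 2 by rewrite exprMn lbE; ring.
  by nra.
have : t * (7 / 4 * lb * A) <= t * (N / 4 + 49 / 4 * (kap * s * L)) by rewrite ler_pM2l.
have lamC : 0 <= lam * C by rewrite mulr_ge0// ltW.
rewrite lamE in lamC *; nra.
Qed.

(** The gain [(A4 - tau) L k] splits in two. The part [A4/M * (M + 2)/2] meets the threshold
    condition and yields [(M + 2)/2 * (1 + 16 kap) s L]: this pays for [2 s L], for the
    compatibility term since [8 (M + 2) > 49/4], and, with the surplus [(M - 2)/2 * s L], for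
    [s (l4 + 1)]. The remaining [tau L k >= tau L] pays for [b]. *)
Lemma exponent_budget (A4 M L kap s k l4 b le : R) :
  let tau := A4 * (M - 2) / (4 * M) in
  0 < A4 -> 2 < M -> 0 <= L -> 0 <= kap -> 0 <= s -> 1 <= k ->
  M / A4 * (1 + 16 * kap) * s <= k ->
  l4 + 1 <= (M - 2) / 2 * L -> b - tau * L <= le ->
  s * l4 + 49 / 4 * kap * s * L + 2 * s * L + s + b - (A4 - tau) * L * k <= le.
Proof.
move=> tau A40 M2 L0 kap0 s0 k1 kM h4 hb.
have M0 : 0 < M by apply: lt_trans M2.
have tau0 : 0 <= tau.
  by rewrite /tau !mulr_ge0 ?invr_ge0 ?mulr_ge0// ?ltW// subr_gt0.
have tauE : A4 - tau = A4 / M * ((M + 2) / 2) + tau.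
  by rewrite /tau; field; rewrite gt_eqF.
have kM' : (1 + 16 * kap) * s <= A4 / M * k.
  have -> : (1 + 16 * kap) * s = A4 / M * (M / A4 * (1 + 16 * kap) * s).
    by field; rewrite !gt_eqF.
  by rewrite ler_pM2l// divr_gt0.
have h1 : L * ((M + 2) / 2) * ((1 + 16 * kap) * s) <= L * ((M + 2) / 2) * (A4 / M * k).
  by apply: ler_wpM2l => //; rewrite mulr_ge0//; lra.
have h2 : tau * L * 1 <= tau * L * k by apply: ler_wpM2l => //; rewrite mulr_ge0.
have h3 : s * (l4 + 1) <= s * ((M - 2) / 2 * L) by apply: ler_wpM2l.
have h5 : 0 <= L * kap * s by rewrite !mulr_ge0.
have h6 : 2 * (L * kap * s) <= M * (L * kap * s) by apply: ler_wpM2r => //; exact: ltW.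
rewrite tauE; nra.
Qed.

Lemma eventually_budget (A2 A4 M eps : R) :
  0 < A2 -> 0 < A4 -> 2 < M -> 0 < eps ->
  let tau := A4 * (M - 2) / (4 * M) in
  exists B : R, forall L, B <= L ->
    [/\ 1 <= L, 8 * A2 <= expR (tau * L), ln 4 + 1 <= (M - 2) / 2 * L,
        2 * Num.sqrt L + 2 - tau * L <= ln eps & 2 * expR (- L) <= eps].
Proof.
move=> A20 A40 M2 eps0 tau.
have M0 : 0 < M by apply: lt_trans M2.
have tau0 : 0 < tau by rewrite /tau !mulr_gt0 ?invr_gt0 ?mulr_gt0// subr_gt0.
have m20 : 0 < M - 2 by rewrite subr_gt0.
exists (Num.max 1 (Num.max (ln (8 * A2) / tau) (Num.max (2 * (ln 4 + 1) / (M - 2))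
  (Num.max (2 * (2 / tau + 2 - ln eps) / tau) (ln (2 / eps)))))) => L.
rewrite !ge_max => /and5P[L1 La Lb Lc Ld]; split=> //.
- rewrite -[leLHS]lnK ?posrE ?mulr_gt0// ler_expR [leRHS]mulrC.
  by rewrite -ler_pdivrMr.
- move: Lb; rewrite ler_pdivrMr//; nra.
- have L0 : 0 <= L by apply: le_trans L1.
  have := sqr_sqrtr L0; have := sqrtr_ge0 L; set r := Num.sqrt L => r0 rE.
  (* Only half of [tau L] is spent on the square root; the other half exceeds the constants by the
     choice of the fourth term of the maximum. *)
  have h : 2 * r <= tau * L / 2 + 2 / tau.
    apply: le_addr_of_sqr; [by rewrite divr_ge0// mulr_ge0// ltW|by rewrite divr_ge0// ltW|].
    have -> : 4 * (tau * L / 2) * (2 / tau) = 4 * L by field; rewrite gt_eqF.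
    by rewrite exprMn rE; lra.
  move: Lc; rewrite ler_pdivrMr//; nra.
- rewrite -ler_pdivlMl// mulrC; rewrite -[leRHS]invrK expRN lef_pV2 ?posrE ?expR_gt0 ?invr_gt0 ?divr_gt0//.
  by rewrite invf_div -[leLHS]lnK ?posrE ?divr_gt0// ler_expR.
Qed.

(** Induction through $(1 + 1/t)^t \le e$. It trades the $s^s$ of the box volume for the $s!$ that
    the binomial coefficient can absorb. *)
Lemma expn_self_le_fact (s : nat) : (s%:R : R) ^+ s <= expR s%:R * (s`!)%:R.
Proof.
elim: s => [|s IH]; first by rewrite expr0 expR0 fact0 mulr1.
case: s IH => [_|s IH].
  by rewrite expr1 mulr1; apply: ltW; rewrite expR_gt1.
set t : R := s.+1%:R in IH *; have t0 : 0 < t by rewrite ltr0n.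
have tE : s.+2%:R = t + 1 :> R by rewrite /t -[in LHS]natr1.
have h : (1 + t^-1) ^+ s.+1 <= expR 1.
  have -> : expR 1 = expR t^-1 ^+ s.+1 by rewrite -expRM_natr mulVf// gt_eqF.
  apply: lerXn2r; rewrite ?nnegrE ?expR_ge0 ?expR_ge1Dx//.
  by rewrite addr_ge0// invr_ge0 ltW.
have -> : s.+2%:R ^+ s.+2 = (t + 1) * ((1 + t^-1) ^+ s.+1 * t ^+ s.+1).
  by rewrite tE exprS -exprMn; congr (_ * _ ^+ _); field; rewrite gt_eqF.
have -> : expR s.+2%:R * (s.+2)`!%:R = (t + 1) * (expR 1 * (expR t * (s.+1)`!%:R)).
  by rewrite factS natrM tE expRD; ring.
apply: ler_wpM2l; first by rewrite addr_ge0// ltW.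
by apply: ler_pM; rewrite ?exprn_ge0 ?addr_ge0 ?invr_ge0 ?(ltW t0).
Qed.

End Numeric.

(** * Dimension prior *)

Section Prior.
Variable R : realType.

Lemma sum_set_card p (h : nat -> R) :
  \sum_(S : {set 'I_p}) h #|S| / 'C(p, #|S|)%:R = \sum_(s < p.+1) h s.
Proof.
have cardp (S : {set 'I_p}) : (#|S| < p.+1)%N.
  by rewrite ltnS -[X in (_ <= X)%N]card_ord max_card.
rewrite (partition_big (fun S => Ordinal (cardp S)) predT) //=.
apply: eq_bigr => s _.
transitivity (\sum_(S in [set S : {set 'I_p} | #|S| == s]) h s / 'C(p, s)%:R).
  apply: eq_big => S; first by rewrite inE -val_eqE.
  by move=> /eqP <-.
rewrite sumr_const card_draws card_ord -[LHS]mulr_natr divfK// pnatr_eq0 -lt0n bin_gt0.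
by rewrite -ltnS.
Qed.

Variables (p : nat) (pi : nat -> R).

Lemma prior_growth (r : R) s k : 0 <= r ->
  (forall s, (1 <= s <= p)%N -> pi s <= r * pi s.-1) ->
  (s + k <= p)%N -> pi (s + k)%N <= r ^+ k * pi s.
Proof.
move=> r0 H; elim: k => [|k IH] sk; first by rewrite addn0 mul1r.
rewrite addnS in sk *; apply: le_trans (H _ _) _ => //=.
by rewrite exprS -mulrA; apply: ler_wpM2l => //; apply: IH; exact: ltnW.
Qed.

(** If [pi 0] vanished, the upper recursion would kill every weight, against total mass one; the
    lower recursion then propagates positivity. *)
Lemma prior_gt0 (r1 r2 : R) s : 0 < r1 -> 0 <= r2 -> is_prob_on p pi ->
  (forall s, (1 <= s <= p)%N -> r1 * pi s.-1 <= pi s /\ pi s <= r2 * pi s.-1) ->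
  (s <= p)%N -> 0 < pi s.
Proof.
move=> r10 r20 [pi0 pi1] H; elim: s => [_|s IH sp].
  rewrite lt_neqAle pi0// andbT; apply/eqP => p0.
  move: pi1; rewrite big1; first by move/esym/eqP; rewrite oner_eq0.
  move=> s _; have sp : (s <= p)%N by rewrite -ltnS.
  apply/eqP; rewrite eq_le pi0// andbT.
  have := @prior_growth r2 0%N s r20; rewrite add0n -p0 mulr0; apply=> //.
  by move=> j jp; case: (H j jp).
apply: lt_le_trans (H s.+1 _).1 => /=; last by rewrite sp.
by rewrite mulr_gt0// IH// ltnW.
Qed.

(* [(p s)^-s] is, up to a factor in [expR (- b)], the Laplace mass of the box
   of half-width [1 / (lam p s)] around the true parameter; for [s = 0] it is
   [1]. *)
Definition evidence_const (s : nat) (b : R) : R :=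
  pi s / 'C(p, s)%:R * (((p%:R * s%:R) ^+ s)^-1 * expR (- b)).

Lemma evidence_const_gt0 s b : (0 < p)%N -> (s <= p)%N -> 0 < pi s ->
  0 < evidence_const s b.
Proof.
move=> p0 sp ps; rewrite !mulr_gt0 ?invr_gt0 ?expR_gt0 ?ltr0n ?bin_gt0//.
case: s {sp ps} => [|s]; first by rewrite expr0.
by rewrite exprn_gt0// mulr_gt0 ?ltr0n.
Qed.

(** Combines $s^s \le e^s s!$ with $\binom{p}{s} s! \le p^s$: the binomial weight and the box
    together cost at most $(e p^2)^s$. *)
Lemma evidence_const_ge s b : (0 < p)%N -> (s <= p)%N -> 0 < pi s ->
  pi s <= evidence_const s b * expR (b + 2 * s%:R * ln p%:R + s%:R).
Proof.
move=> p0 sp ps; rewrite /evidence_const.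
have C0 : 0 < 'C(p, s)%:R :> R by rewrite ltr0n bin_gt0.
have pp0 : 0 < p%:R :> R by rewrite ltr0n.
have D0 : 0 < (p%:R * s%:R) ^+ s :> R.
  case: (s) => [|s']; first by rewrite expr0.
  by rewrite exprn_gt0// mulr_gt0 ?ltr0n.
have pE : expR (2 * s%:R * ln p%:R) = p%:R ^+ s * p%:R ^+ s :> R.
  have -> : 2 * s%:R * ln p%:R = ln p%:R * s%:R + ln p%:R * s%:R :> R by ring.
  by rewrite expRD !expRM_natr lnK ?posrE.
rewrite !expRD pE.
have -> : pi s / 'C(p, s)%:R * (((p%:R * s%:R) ^+ s)^-1 * expR (- b)) *
   (expR b * (p%:R ^+ s * p%:R ^+ s) * expR s%:R)
   = pi s * ((p%:R ^+ s * p%:R ^+ s * expR s%:R) / ('C(p, s)%:R * (p%:R * s%:R) ^+ s)).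
  by rewrite expRN; field; rewrite !gt_eqF ?expR_gt0.
rewrite ler_peMr ?(ltW ps)// ler_pdivlMr ?mulr_gt0// mul1r exprMn.
rewrite mulrCA -[leRHS]mulrA ler_pM2l ?exprn_gt0//.
apply: (le_trans (ler_wpM2l (ltW C0) (expn_self_le_fact R s))).
rewrite mulrCA mulrC ler_pM2r ?expR_gt0// -natrM bin_ffact -natrX ler_nat.
elim: (s) => [|s' IH]; first by rewrite ffactn0.
by rewrite ffactnSr expnSr leq_mul// leq_subr.
Qed.

(** The exact remainder makes the induction close; for [m <= s0.+1] the sum is empty and truncated
    subtraction makes the right side zero. *)
Lemma geometric_tail s0 m :
  \sum_(s < m | (s0 < s)%N) (2 : R)^-1 ^+ (s - s0) <= 1 - 2^-1 ^+ (m - s0.+1).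
Proof.
elim: m => [|m IH]; first by rewrite big_ord0 sub0n expr0 subrr.
rewrite big_mkcond big_ord_recr -big_mkcond /=; have [sm|sm] := ltnP s0 m.
  rewrite subSS; apply: le_trans (lerD IH (lexx _)) _.
  have -> : (m - s0 = (m - s0.+1).+1)%N by rewrite subnSK.
  by rewrite exprS; have := exprn_ge0 (m - s0.+1) (ltW (_ : 0 < (2 : R)^-1)); lra.
rewrite addr0; apply: le_trans IH _.
by have -> : (m - s0.+1 = m.+1 - s0.+1)%N by apply/eqP; rewrite subSS subnS (eqP (_ : (m - s0)%N == 0%N)) ?subn_eq0.
Qed.

(** A dimension [s0 + k] beyond the threshold contributes at most [2^-1 ^+ k * e], by
    [prior_growth], [evidence_const_ge] and [exponent_budget]; the geometric series does the
    rest. *)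
Lemma prior_tail (A2 A4 M kap e : R) (s0 : nat) :
  let L := ln p%:R in
  let b := 2 * Num.sqrt L + 2 in
  let tau := A4 * (M - 2) / (4 * M) in
  (0 < p)%N -> (s0 <= p)%N -> 0 < pi s0 -> 0 <= kap -> 0 < e ->
  0 < A2 -> 0 < A4 -> 2 < M ->
  (forall s, (1 <= s <= p)%N -> pi s <= A2 * powR p%:R (- A4) * pi s.-1) ->
  0 <= L -> 8 * A2 <= expR (tau * L) -> ln 4 + 1 <= (M - 2) / 2 * L ->
  b - tau * L <= ln e ->
  \sum_(s < p.+1 | s0%:R + M / A4 * (1 + 16 * kap) * s0%:R < s%:R)
     pi s * 4 ^+ s * (expR (49 / 4 * kap * s0%:R * L) / evidence_const s0 b) <= e.
Proof.
move=> L b tau p0 s0p ps0 kap0 e0 A20 A40 M2 H L0 h8 h4 hb.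
have M0 : 0 < M by apply: lt_trans M2.
have c0 := evidence_const_gt0 b p0 s0p ps0.
set K0 := M / A4 * (1 + 16 * kap) * s0%:R.
have K00 : 0 <= K0.
  by rewrite !mulr_ge0 ?invr_ge0 ?addr_ge0 ?mulr_ge0// ltW.
have pE : powR p%:R (- A4) = expR (- A4 * L) by rewrite /powR pnatr_eq0 gtn_eqF.
apply: (@le_trans _ _ (\sum_(s < p.+1 | (s0 < s)%N) 2^-1 ^+ (s - s0) * e)); last first.
  rewrite -mulr_suml -[leRHS]mul1r ler_pM2r//; apply: le_trans (geometric_tail _ _) _.
  by rewrite gerBl exprn_ge0.
rewrite big_mkcond [leRHS]big_mkcond /=; apply: ler_sum => s _.
case: ifPn => [hs|_]; last first.
  by case: ifP => // _; rewrite mulr_ge0 ?(ltW e0) ?exprn_ge0.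
have s0s : (s0 < s)%N.
  by rewrite -(ltr_nat R); apply: le_lt_trans hs; rewrite lerDl.
rewrite s0s; set k := (s - s0)%N.
have sE : s = (s0 + k)%N :> nat by rewrite subnKC// ltnW.
have sp : (s0 + k <= p)%N by rewrite -sE -ltnS.
have k1 : 1 <= k%:R :> R by rewrite ler1n subn_gt0.
have kK : K0 <= k%:R.
  by move: hs; rewrite sE natrD ltrD2l => /ltW.
have r0 : 0 <= A2 * powR p%:R (- A4) by rewrite mulr_ge0 ?powR_ge0// ltW.
(* One [tau] is spent here on the constant [8 * A2]: the [4] comes from [4 ^+ s], the other factor
   [2] creates the geometric ratio. *)
have q0 : 4 * (A2 * powR p%:R (- A4)) <= 2^-1 * expR (- ((A4 - tau) * L)).
  rewrite pE (_ : - ((A4 - tau) * L) = tau * L + - A4 * L); last by ring.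
  rewrite expRD; have := expR_gt0 (- A4 * L); nra.
have qk : (4 * (A2 * powR p%:R (- A4))) ^+ k
   <= 2^-1 ^+ k * expR (- ((A4 - tau) * L * k%:R)).
  rewrite -mulNr expRM_natr -exprMn; apply: lerXn2r; rewrite ?nnegrE ?mulr_ge0 ?expR_ge0 ?powR_ge0// ?ltW//.
set Q := 49 / 4 * kap * s0%:R * L.
have bud := @exponent_budget R A4 M L kap s0%:R k%:R (ln 4) b (ln e) A40 M2 L0 kap0 (ler0n _ _) k1 kK h4 hb.
have e4 : 4 ^+ s0 = expR (s0%:R * ln 4) :> R.
  by rewrite mulrC expRM_natr lnK ?posrE.
rewrite sE [X in X <= _](_ : _ = pi (s0 + k)%N * 4 ^+ s0 * expR Q * 4 ^+ k
  / evidence_const s0 b); last by rewrite exprD; ring.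
rewrite ler_pdivrMr//.
move: (evidence_const s0 b) c0 (evidence_const_ge b p0 s0p ps0) => c c0 c1.
rewrite -/L in c1.
apply: (@le_trans _ _ ((4 * (A2 * powR p%:R (- A4))) ^+ k * (expR (s0%:R * ln 4) *
   (expR Q * (c * expR (b + 2 * s0%:R * L + s0%:R)))))).
  rewrite exprMn e4.
  have -> : pi (s0 + k)%N * expR (s0%:R * ln 4) * expR Q * 4 ^+ k
     = 4 ^+ k * (expR (s0%:R * ln 4) * expR Q) * pi (s0 + k)%N by ring.
  have -> : 4 ^+ k * (A2 * powR p%:R (- A4)) ^+ k * (expR (s0%:R * ln 4) *
   (expR Q * (c * expR (b + 2 * s0%:R * L + s0%:R)))) =
    4 ^+ k * (expR (s0%:R * ln 4) * expR Q) * ((A2 * powR p%:R (- A4)) ^+ k *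
      (c * expR (b + 2 * s0%:R * L + s0%:R))) by ring.
  apply: ler_wpM2l; first by rewrite !mulr_ge0 ?expR_ge0 ?exprn_ge0.
  apply: le_trans (prior_growth r0 H sp) _.
  by apply: ler_wpM2l => //; rewrite exprn_ge0.
apply: le_trans (ler_wpM2r _ qk) _.
  by apply: mulr_ge0 (expR_ge0 _) (mulr_ge0 (expR_ge0 _) (mulr_ge0 (ltW c0) (expR_ge0 _))).
rewrite -!mulrA ler_pM2l ?exprn_gt0 ?invr_gt0//.
set ex := expR (b + _ + _) in c1 *.
have -> : forall x y z : R, x * (y * (z * (c * ex))) = x * y * z * ex * c.
  by move=> x y z; ring.
rewrite ler_pM2r// /ex -!expRD -[leRHS]lnK ?posrE// ler_expR.
by rewrite -/tau in bud; move: bud; rewrite /Q; lra.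
Qed.

End Prior.

(** * Design matrix and compatibility *)

Section Design.
Variables (R : realType) (n p : nat) (X : 'M[R]_(n, p)).

Lemma sqnorm_ge0 k (v : 'I_k -> R) : 0 <= sqnorm v.
Proof. by apply: sumr_ge0 => i _; exact: sqr_ge0. Qed.

Lemma l1on_ge0 (S : {set 'I_p}) (b : 'I_p -> R) : 0 <= l1on S b.
Proof. exact: sumr_ge0. Qed.

Lemma colnorm_ge0 : 0 <= colnorm X.
Proof. by rewrite /colnorm; elim/big_ind: _ => // x y x0 y0; rewrite le_max x0. Qed.

Lemma sqnorm_col_le i : \sum_(j < n) X j i ^+ 2 <= colnorm X ^+ 2.
Proof.
have s0 : 0 <= \sum_(j < n) X j i ^+ 2 by apply: sumr_ge0 => j _; exact: sqr_ge0.
rewrite -[leLHS]sqr_sqrtr//; apply: lerXn2r; rewrite ?nnegrE ?sqrtr_ge0 ?colnorm_ge0//.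
by rewrite /colnorm (bigD1 i)//= le_max lexx.
Qed.

(** Expand through the Gram matrix, whose entries are bounded by [colnorm X ^+ 2] because $2xy \le
    x^2 + y^2$. *)
Lemma sqnorm_mulXb_le (d : 'I_p -> R) :
  sqnorm (mulXb X d) <= colnorm X ^+ 2 * (\sum_(i < p) `|d i|) ^+ 2.
Proof.
have -> : sqnorm (mulXb X d) =
    \sum_(j < p) \sum_(k < p) (d j * d k) * \sum_(i < n) X i j * X i k.
  rewrite /sqnorm /mulXb.
  under eq_bigr do rewrite expr2 big_distrlr /=.
  rewrite exchange_big /=; apply: eq_bigr => j _.
  rewrite exchange_big /=; apply: eq_bigr => k _.
  by rewrite mulr_sumr; apply: eq_bigr => i _; ring.
rewrite [(\sum_(i < p) _) ^+ 2]expr2 big_distrlr /= mulr_sumr; apply: ler_sum => j _.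
rewrite mulr_sumr; apply: ler_sum => k _.
apply: le_trans (ler_norm _) _; rewrite normrM normrM mulrC.
apply: ler_wpM2r; first exact: mulr_ge0.
apply: le_trans (ler_norm_sum _ _ _) _.
apply: (@le_trans _ _ (\sum_(i < n) (X i j ^+ 2 + X i k ^+ 2) / 2)).
  apply: ler_sum => i _; rewrite normrM.
  rewrite -[X i j ^+ 2]real_normK ?num_real// -[X i k ^+ 2]real_normK ?num_real//.
  by have := sqr_ge0 (`|X i j| - `|X i k|); nra.
rewrite -mulr_suml big_split /=.
by have := sqnorm_col_le j; have := sqnorm_col_le k; lra.
Qed.

Lemma l1on_setC (S : {set 'I_p}) (d : 'I_p -> R) :
  \sum_(i < p) `|d i| = l1on S d + l1on (~: S) d.
Proof.
rewrite (bigID (mem S)) /=; congr (_ + _).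
by apply: eq_bigl => i; rewrite inE.
Qed.

Lemma sum_supported (S : {set 'I_p}) (F : 'I_p -> R) :
  (forall i, i \notin S -> F i = 0) -> \sum_(i in S) F i = \sum_(i < p) F i.
Proof.
by move=> H; rewrite [RHS](bigID (mem S))/= [X in _ + X]big1 ?addr0.
Qed.

(** Off the support of [b0] the difference is [b] itself; on it the triangle inequality applies. *)
Lemma l1_descent (b0 b : 'I_p -> R) :
  \sum_(i < p) `|b0 i| - \sum_(i < p) `|b i| <=
  l1on (supp b0) (fun i => b i - b0 i) - l1on (~: supp b0) (fun i => b i - b0 i).
Proof.
rewrite !(l1on_setC (supp b0)) opprD addrACA.
have -> : l1on (~: supp b0) b0 = 0.
  by apply: big1 => i; rewrite !inE negbK => /eqP ->; rewrite normr0.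
have -> : l1on (~: supp b0) (fun i => b i - b0 i) = l1on (~: supp b0) b.
  by apply: eq_bigr => i; rewrite !inE negbK => /eqP ->; rewrite subr0.
rewrite sub0r lerB// -sumrB; apply: ler_sum => i _.
by rewrite distrC; exact: lerB_dist.
Qed.

(** The coefficients [3/2] and [-1/2] of [compat_exponent] arise as [1 + 1/2] and [-1 + 1/2]: the
    descent inequality plus half of [lam] times the full l1 norm. *)
Lemma compat_exponent_vec (lam L kap : R) (b0 b : 'I_p -> R) (S : {set 'I_p}) :
  let lb := lambar X in let d i := b i - b0 i in
  0 < lam -> 0 < lb -> lb ^+ 2 = 4 * colnorm X ^+ 2 * L -> 0 <= L -> 0 <= kap ->
  (forall i, i \notin S -> b i = 0) ->
  (forall d, 7 * l1on (supp b0) d <= l1on (~: supp b0) d \/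
     l1on (supp b0) d ^+ 2 * colnorm X ^+ 2 <= kap * sqnorm (mulXb X d) * #|supp b0|%:R) ->
  lam * \sum_(i < p) `|b0 i| - lam * \sum_(i in S) `|b i|
    + lam / 2 * \sum_(i < p) `|d i| - lam / (4 * lb) * sqnorm (mulXb X d)
  <= - (lam / 4 * \sum_(i in S) `|d i|) + 49 / 4 * (kap * (lam / lb)) * #|supp b0|%:R * L.
Proof.
move=> lb d lam0 lb0 lbE L0 kap0 bS H.
have := compat_exponent lam0 lb0 lbE L0 kap0 (ler0n _ #|supp b0|)
  (l1on_ge0 (supp b0) d) (l1on_ge0 (~: supp b0) d) (sqnorm_ge0 (mulXb X d)) (H d).
have h1 : \sum_(i in S) `|d i| <= l1on (supp b0) d + l1on (~: supp b0) d.
  rewrite -l1on_setC [leRHS](bigID (mem S))/= lerDl; exact: sumr_ge0.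
have := ler_wpM2l (ltW lam0) h1.
have := ler_wpM2l (ltW lam0) (l1_descent b0 b); rewrite -/d.
rewrite (@sum_supported S (fun i => `|b i|)); last by move=> i /bS ->; rewrite normr0.
rewrite (l1on_setC (supp b0) d).
move: (lam / (4 * lb) * _) => N; move: (49 / 4 * _ * _ * _) => Q.
rewrite !mulrBr !mulrDr; lra.
Qed.

(** Separates the degenerate case of a zero compatibility number on a nonempty [S], where the
    threshold is infinite, from the cases governed by a real [kap]: zero for empty [S], otherwise
    $\phi(S)^{-2}$. The final dichotomy is whether [d] leaves the cone or obeys the compatibility
    inequality. *)
Lemma compat_cases (S : {set 'I_p}) : 0 < colnorm X ->
  (S != finset.set0 /\ compat X S = 0%E) \/
  exists kap : R, [/\ 0 <= kap,
    forall M A4 lam lb, threshold M A4 lam lb #|S| (compat X S) =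
      (#|S|%:R + M / A4 * (1 + 16 * (kap * (lam / lb))) * #|S|%:R)%:E &
    forall d, 7 * l1on S d <= l1on (~: S) d \/
      l1on S d ^+ 2 * colnorm X ^+ 2 <= kap * sqnorm (mulXb X d) * #|S|%:R].
Proof.
move=> X0; have [->|[i0 i0S]] := set_0Vmem S.
  right; exists 0; split=> //.
  - move=> M A4 lam lb; rewrite cards0 !mulr0 addr0.
    have -> : compat X finset.set0 = +oo%E.
      rewrite /compat (_ : image _ _ = classical_sets.set0) ?ereal_inf0//.
      rewrite -subset0 => x [b [_ [i]]]; by rewrite inE.
    by rewrite /= mulr0 addr0.
  - move=> d; left; rewrite {1}/l1on big1 ?mulr0 ?l1on_ge0// => i; by rewrite inE.
have S0 : S != finset.set0 by apply/set0Pn; exists i0.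
set E := [set b : 'I_p -> R | l1on (~: S) b <= 7 * l1on S b /\
   exists2 i, i \in S & b i != 0]%classic.
pose f (b : 'I_p -> R) := Num.sqrt (sqnorm (mulXb X b)) * Num.sqrt (#|S|%:R)
                  / (colnorm X * l1on S b).
have f0 b : 0 <= f b.
  by rewrite divr_ge0 ?mulr_ge0 ?sqrtr_ge0 ?l1on_ge0 ?(ltW X0).
have inf0 : (0 <= compat X S)%E.
  by apply: le_ereal_inf_tmp => _ [b _ <-]; rewrite lee_fin; exact: f0.
have infle b : E b -> (compat X S <= (f b)%:E)%E.
  by move=> Eb; apply: ereal_inf_lbound; exists b.
(* A coordinate vector is admissible, so the infimum over a nonempty [S] is not [+oo]. *)
pose b1 (i : 'I_p) : R := (i == i0)%:R.
have Eb1 : E b1.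
  split; last by exists i0; rewrite // /b1 eqxx oner_eq0.
  have -> : l1on (~: S) b1 = 0.
    apply: big1 => i; rewrite inE /b1; case: eqP => [->|_]; first by rewrite i0S.
    by rewrite normr0.
  by rewrite mulr_ge0 ?l1on_ge0.
case E1: (compat X S) inf0 infle => [r| |] inf0 infle; last by rewrite leeNy_eq in inf0.
  rewrite lee_fin in inf0.
  have [r0|r0] := eqVneq r 0; first by left; rewrite r0.
  right; exists (r ^- 2); split=> //.
  - by rewrite invr_ge0 sqr_ge0.
  - by move=> M A4 lam lb; rewrite /= (negbTE r0) !mulrA.
  - move=> d; have [A0|A0] := eqVneq (l1on S d) 0.
      by left; rewrite A0 mulr0 l1on_ge0.
    have [|C7] := leP (7 * l1on S d) (l1on (~: S) d); [by left|right].
    have Ed : E d.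
      split; first exact: ltW.
      apply: contrapT => Hd; case/eqP: A0; apply: big1 => i iS.
      have [->|di] := eqVneq (d i) 0; first by rewrite normr0.
      by case: Hd; exists i.
    have Ap : 0 < l1on S d by rewrite lt_neqAle eq_sym A0 l1on_ge0.
    have := infle d Ed; rewrite lee_fin /f ler_pdivlMr ?mulr_gt0// => h.
    have : (r * (colnorm X * l1on S d)) ^+ 2 <=
        (Num.sqrt (sqnorm (mulXb X d)) * Num.sqrt #|S|%:R) ^+ 2.
      by apply: lerXn2r; rewrite ?nnegrE ?mulr_ge0 ?sqrtr_ge0 ?(ltW X0) ?(ltW Ap).
    rewrite [X in _ <= X -> _]exprMn !sqr_sqrtr ?sqnorm_ge0// exprMn.
    have r2 : 0 < r ^+ 2 by rewrite exprn_even_gt0.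
    by move=> h2; rewrite -mulrA ler_pdivlMl// [l1on _ _ ^+ 2 * _]mulrC -exprMn.
have := infle b1 Eb1; by rewrite leye_eq.
Qed.

End Design.

(** * Integrals over slices and the posterior *)

Section SliceIntegral.
Variables (R : realType) (p : nat).
Implicit Types (S : {set 'I_p}) (f g : ('I_p -> R) -> \bar R).

Definition supported S (b : 'I_p -> R) := forall i, i \notin S -> b i = 0.

Lemma int_RS_ge0 S f : (forall b, supported S b -> 0 <= f b)%E -> (0 <= int_RS S f)%E.
Proof.
by move=> H; apply: iint_ge0 => b Hb; apply: H => i iS; apply: Hb; rewrite mem_enum.
Qed.

Lemma int_RS_le S f g : (forall b, supported S b -> 0 <= f b)%E ->
  (forall b, supported S b -> f b <= g b)%E -> (int_RS S f <= int_RS S g)%E.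
Proof.
by move=> H0 H; apply: iint_le => b Hb; [apply: H0|apply: H] => i iS; apply: Hb; rewrite mem_enum.
Qed.

Lemma int_RS_eq S f g : (forall b, supported S b -> f b = g b) -> int_RS S f = int_RS S g.
Proof.
by move=> H; apply: eq_iint => b Hb; apply: H => i iS; apply: Hb; rewrite mem_enum.
Qed.

Lemma int_RS0 S : int_RS S (fun=> 0%E : \bar R) = 0%E.
Proof. exact: iint0. Qed.

Lemma int_RS_prod S (F : 'I_p -> R -> R) (c : R) :
  (forall i x, 0 <= F i x) ->
  (forall i, measurable_fun setT (F i : measurableTypeR R -> measurableTypeR R)) ->
  (forall i, i \in S -> (\int[@lebesgue_measure R]_x (F i x)%:E = c%:E)%E) ->
  int_RS S (fun b => (\prod_(i in S) F i (b i))%:E) = (c ^+ #|S|)%:E.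
Proof.
move=> F0 mF Fc.
transitivity (int_RS S (fun b => (\prod_(i <- enum S) F i (b i))%:E)).
  by apply: int_RS_eq => b _; rewrite big_enum.
rewrite /int_RS (@iint_prod _ _ _ F (fun=> c)) ?enum_uniq//.
  by rewrite big_enum /= prodr_const.
by move=> i; rewrite mem_enum; exact: Fc.
Qed.

Lemma laplace_ge0 (lam x : R) : 0 <= lam -> 0 <= laplace lam x.
Proof. by move=> l0; rewrite mulr_ge0 ?divr_ge0 ?expR_ge0. Qed.

Lemma measurable_expRNabs (c m : R) :
  measurable_fun setT ((fun x : R => expR (- (c * `|x - m|))) :
     measurableTypeR R -> measurableTypeR R).
Proof.
apply: measurableT_comp => //; apply: measurableT_comp => //.
apply: measurable_funM => //; apply: measurableT_comp => //.
exact: measurable_funB.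
Qed.

(** Rate and centre are free: [lam] and [0] give finiteness of the prior integral, [lam / 4] and
    [b0] bound the numerator. *)
Lemma int_RS_laplace S (lam c : R) (m : 'I_p -> R) : 0 < lam -> 0 < c ->
  int_RS S (fun b => (\prod_(i in S) (lam / 2 * expR (- (c * `|b i - m i|))))%:E)
  = ((lam / c) ^+ #|S|)%:E.
Proof.
move=> l0 c0; apply: (@int_RS_prod S (fun i x => lam / 2 * expR (- (c * `|x - m i|)))).
- by move=> i x; rewrite mulr_ge0 ?expR_ge0// divr_ge0// ltW.
- by move=> i; apply: measurable_funM => //; exact: measurable_expRNabs.
- move=> i _; under eq_integral do rewrite EFinM.
  rewrite (@ge0_integralZl _ (measurableTypeR R))//.
  + rewrite integral_expRNabs// -EFinM; congr EFin; field; by rewrite gt_eqF.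
  + by apply/measurable_EFinP; exact: measurable_expRNabs.
  + by rewrite lee_fin divr_ge0// ltW.
Qed.

Lemma prior_int_ge0 (pi : nat -> R) lam (f : ('I_p -> R) -> R) :
  (forall s, (s <= p)%N -> 0 <= pi s) -> 0 <= lam -> (forall b, 0 <= f b) ->
  (0 <= prior_int pi lam f)%E.
Proof.
move=> pi0 l0 f0; apply: sume_ge0 => S _; apply: mule_ge0.
  by rewrite lee_fin divr_ge0// pi0// -[X in (_ <= X)%N](card_ord p) max_card.
apply: int_RS_ge0 => b _; rewrite lee_fin mulr_ge0//.
by apply: prodr_ge0 => i _; exact: laplace_ge0.
Qed.

Lemma card_le_p S : (#|S| <= p)%N.
Proof. by rewrite -[X in (_ <= X)%N](card_ord p) max_card. Qed.

Lemma prior_weight_ge0 (pi : nat -> R) S :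
  (forall s, (s <= p)%N -> 0 <= pi s) -> 0 <= pi #|S| / 'C(p, #|S|)%:R.
Proof. by move=> pi0; rewrite divr_ge0// pi0// card_le_p. Qed.

Lemma prior_int_le (pi : nat -> R) lam (f g : ('I_p -> R) -> R) :
  (forall s, (s <= p)%N -> 0 <= pi s) -> 0 <= lam -> (forall b, 0 <= f b) ->
  (forall b, f b <= g b) -> (prior_int pi lam f <= prior_int pi lam g)%E.
Proof.
move=> pi0 l0 f0 fg; apply: lee_sum => S _; apply: lee_wpmul2l.
  by rewrite lee_fin prior_weight_ge0.
have lap0 b : 0 <= \prod_(i in S) laplace lam (b i).
  by apply: prodr_ge0 => i _; exact: laplace_ge0.
apply: int_RS_le => b _; first by rewrite lee_fin mulr_ge0.
by rewrite lee_fin ler_wpM2r.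
Qed.

(** Ensures that [fine] in [posterior] does not collapse an infinite integral to zero. *)
Lemma prior_int_fin (pi : nat -> R) lam (f : ('I_p -> R) -> R) :
  (forall s, (s <= p)%N -> 0 <= pi s) -> 0 < lam -> (forall b, 0 <= f b <= 1) ->
  (prior_int pi lam f < +oo)%E.
Proof.
move=> pi0 l0 f1; apply: lte_sum_pinfty => S _; apply: lte_mul_pinfty => //.
- by rewrite lee_fin prior_weight_ge0.
- have lap0 b : 0 <= \prod_(i in S) laplace lam (b i).
    by apply: prodr_ge0 => i _; apply/laplace_ge0/ltW.
  apply: (@le_lt_trans _ _ ((lam / lam) ^+ #|S|)%:E); last exact: ltry.
  rewrite -(@int_RS_laplace S lam lam (fun=> 0))//; apply: int_RS_le => b _.
    by rewrite lee_fin mulr_ge0//; case/andP: (f1 b).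
  under [in leRHS]eq_bigr do rewrite subr0.
  by rewrite lee_fin ler_piMl//; case/andP: (f1 b).
Qed.

End SliceIntegral.

(** * Likelihood ratios, the score, and crude bounds on the posterior *)

Section Likelihood.
Variables (R : realType) (n p : nat) (X : 'M[R]_(n, p)).

Lemma mulXbB (b b0 : 'I_p -> R) i :
  mulXb X (fun j => b j - b0 j) i = mulXb X b i - mulXb X b0 i.
Proof. by rewrite /mulXb -sumrB; apply: eq_bigr => j _; rewrite mulrBr. Qed.

Lemma lik_gt0 y b : 0 < lik X y b.
Proof. exact: expR_gt0. Qed.

Lemma lik_le1 y b : lik X y b <= 1.
Proof. by rewrite /lik -[leRHS]expR0 ler_expR oppr_le0 divr_ge0 ?sqnorm_ge0. Qed.

(** The coordinates of $X^T(y - X\beta^0)$, the gradient of the log-likelihood at [b0]. *)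
Definition score (b0 : 'I_p -> R) (y : 'I_n -> R) (j : 'I_p) : R :=
  \sum_(i < n) X i j * (y i - mulXb X b0 i).

Lemma score_dot b0 y (d : 'I_p -> R) :
  \sum_(i < n) mulXb X d i * (y i - mulXb X b0 i) = \sum_(j < p) d j * score b0 y j.
Proof.
rewrite /mulXb /score.
under eq_bigr do rewrite mulr_suml.
rewrite exchange_big /=; apply: eq_bigr => j _.
by rewrite mulr_sumr; apply: eq_bigr => i _; rewrite mulrA [X in X * _]mulrC.
Qed.

Lemma score_dot_le (c : R) b0 y (d : 'I_p -> R) :
  (forall j, `|score b0 y j| <= c) ->
  `|\sum_(i < n) mulXb X d i * (y i - mulXb X b0 i)| <= c * \sum_(j < p) `|d j|.
Proof.
move=> H; rewrite score_dot; apply: le_trans (ler_norm_sum _ _ _) _.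
rewrite mulr_sumr; apply: ler_sum => j _.
by rewrite normrM mulrC ler_wpM2r.
Qed.

Lemma lik_ratio y (b b0 : 'I_p -> R) :
  let d i := b i - b0 i in
  lik X y b = lik X y b0 * expR (\sum_(i < n) mulXb X d i * (y i - mulXb X b0 i)
     - sqnorm (mulXb X d) / 2).
Proof.
move=> d; rewrite /lik -expRD; congr expR.
have -> : sqnorm (fun i => y i - mulXb X b i) = sqnorm (fun i => y i - mulXb X b0 i)
   - 2 * (\sum_(i < n) mulXb X d i * (y i - mulXb X b0 i)) + sqnorm (mulXb X d).
  rewrite /sqnorm mulr_sumr -sumrB -big_split /=; apply: eq_bigr => i _.
  by rewrite mulXbB; ring.
by field.
Qed.

(** Covers both degenerate situations: a Laplace density that vanishes because [lam = 0], and an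
    event that is empty because the threshold is infinite. *)
Lemma posterior_null (pi : nat -> R) lam (B : pred ('I_p -> R)) y :
  (forall S b, supported S b -> B b -> \prod_(i in S) laplace lam (b i) = 0) ->
  posterior X pi lam B y = 0.
Proof.
move=> H; rewrite /posterior {1}/prior_int big1 ?mul0r// => S _.
rewrite (@int_RS_eq _ _ S _ (fun=> 0%E)) ?int_RS0 ?mule0// => b Sb.
by case: ifPn => [Bb|_]; rewrite ?mul0r// (H S b) ?mulr0.
Qed.

Lemma posterior_le1 (pi : nat -> R) lam (B : pred ('I_p -> R)) y :
  (forall s, (s <= p)%N -> 0 <= pi s) -> 0 < lam ->
  0 <= posterior X pi lam B y <= 1.
Proof.
move=> pi0 l0; rewrite /posterior.
set N := prior_int _ _ (fun b => if _ then _ else _); set D := prior_int _ _ _.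
have N0 : (0 <= N)%E.
  by apply: prior_int_ge0 => // [|b]; [exact: ltW|case: ifP => // _; exact/ltW/lik_gt0].
have ND : (N <= D)%E.
  apply: prior_int_le => // [|b|b]; first exact: ltW.
    by case: ifP => // _; exact/ltW/lik_gt0.
  by case: ifP => // _; exact/ltW/lik_gt0.
have Doo : (D < +oo)%E.
  by apply: prior_int_fin => // b; rewrite lik_le1 ltW ?lik_gt0.
have Dfin : D \is a fin_num by rewrite ge0_fin_numE// (le_trans N0).
have Nfin : N \is a fin_num by rewrite ge0_fin_numE// (le_lt_trans ND).
have fND : fine N <= fine D by apply: fine_le.
have fN : 0 <= fine N by exact: fine_ge0.
rewrite divr_ge0//= ?(le_trans fN)//.
(* Division by zero yields zero, so the bound survives a vanishing denominator. *)
have [D0|D0] := eqVneq (fine D) 0; first by rewrite D0 invr0 mulr0.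
by rewrite ler_pdivrMr ?mul1r// lt_neqAle eq_sym D0 (le_trans fN).
Qed.

End Likelihood.

(** * Lower bound for the marginal likelihood *)

Section Evidence.
Variables (R : realType) (n p : nat) (X : 'M[R]_(n, p)).
Variables (pi : nat -> R) (lam : R) (b0 : 'I_p -> R).
Hypotheses (p0 : (0 < p)%N) (pi0 : forall s, (s <= p)%N -> 0 <= pi s).
Hypotheses (lam0 : 0 < lam) (lamX : colnorm X / p%:R <= lam).
Local Notation L := (ln (p%:R : R)).
Local Notation S0 := (supp b0).
Local Notation s0 := #|supp b0|.

Lemma prod_laplace (S : {set 'I_p}) (b : 'I_p -> R) :
  \prod_(i in S) laplace lam (b i) = (lam / 2) ^+ #|S| * expR (- (lam * \sum_(i in S) `|b i|)).
Proof.
by rewrite /laplace big_split /= prodr_const -expR_sum mulr_sumr sumrN.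
Qed.

Lemma supp_supported : supported S0 b0.
Proof. by move=> i; rewrite inE negbK => /eqP. Qed.

(** In the box $|d|_1 \le 1/(\lambda p)$. With [lamX] the score term is then at least
    [- 2 * Num.sqrt L], the quadratic term costs at most [1/2] and the change of l1 norm at most
    [1], in total less than [2 * Num.sqrt L + 2]. *)
Lemma evidence_box (b : 'I_p -> R) y :
  (forall j, `|score X b0 y j| <= lambar X) -> supported S0 b ->
  (forall i, i \in S0 -> `|b i - b0 i| <= (lam * (p%:R * s0%:R))^-1) ->
  lik X y b0 * expR (- (lam * \sum_(i < p) `|b0 i|)) * (lam / 2) ^+ s0
    * expR (- (2 * Num.sqrt L + 2))
  <= lik X y b * \prod_(i in S0) laplace lam (b i).
Proof.
move=> good bS box; pose d i := b i - b0 i; set r := (lam * p%:R)^-1.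
have pp : 0 < p%:R :> R by rewrite ltr0n.
have r0 : 0 < r by rewrite invr_gt0 mulr_gt0.
have X0 := colnorm_ge0 X.
have dE : \sum_(i < p) `|d i| = \sum_(i in S0) `|d i|.
  rewrite -(@sum_supported R p S0 (fun i => `|d i|))// => i iS.
  by rewrite /d bS// supp_supported// subr0 normr0.
have dr : \sum_(i < p) `|d i| <= r.
  rewrite dE; apply: le_trans (ler_sum _ box) _; rewrite sumr_const -[_ *+ s0]mulr_natl.
  have [->|s00] := eqVneq (s0%:R : R) 0; first by rewrite mul0r ltW.
  by rewrite mulrA invfM mulrCA mulfV// mulr1.
have d0 : 0 <= \sum_(i < p) `|d i| by exact: sumr_ge0.
have Xr : colnorm X * r <= 1.
  by rewrite /r ler_pdivrMr ?mulr_gt0// mul1r -ler_pdivrMr.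
have lr : lam * r <= 1.
  by rewrite /r invfM mulrA divff ?gt_eqF// mul1r invf_le1// ler1n.
have lbr : lambar X * r <= 2 * Num.sqrt L.
  have -> : lambar X * r = 2 * Num.sqrt L * (colnorm X * r) by rewrite /lambar; ring.
  by rewrite -[leRHS]mulr1 ler_wpM2l// mulr_ge0 ?sqrtr_ge0.
rewrite (lik_ratio X y b b0) -/d prod_laplace.
have [lo _] := ler_normlP _ _ (@score_dot_le _ _ _ _ _ _ _ d good).
set T := \sum_(i < n) _ in lo *.
have NX : sqnorm (mulXb X d) <= 1.
  apply: le_trans (sqnorm_mulXb_le X d) _; rewrite -exprMn -[leRHS](expr1n _ 2).
  apply: lerXn2r; rewrite ?nnegrE ?mulr_ge0//.
  by apply: le_trans Xr; exact: ler_wpM2l.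
have T0 : - (2 * Num.sqrt L) <= T.
  have : lambar X * \sum_(j < p) `|d j| <= lambar X * r.
    by apply: ler_wpM2l => //; rewrite !mulr_ge0 ?sqrtr_ge0.
  by move: lo lbr; lra.
have b1 : lam * \sum_(i in S0) `|b i| <= lam * \sum_(i < p) `|b0 i| + 1.
  apply: (@le_trans _ _ (lam * (\sum_(i < p) `|b0 i| + \sum_(i < p) `|d i|))); last first.
    by rewrite mulrDr lerD2l; apply: le_trans lr; rewrite ler_pM2l.
  rewrite ler_pM2l// dE -(@sum_supported R p S0 (fun i => `|b0 i|)); last first.
    by move=> i /supp_supported ->; rewrite normr0.
  rewrite -big_split /=; apply: ler_sum => i _.
  by rewrite -[X in `|X| <= _](subrK (b0 i)) addrC; exact: ler_normD.
set e1 := expR (T - _).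
have -> : lik X y b0 * e1 * ((lam / 2) ^+ s0 * expR (- (lam * \sum_(i in S0) `|b i|)))
   = lik X y b0 * (lam / 2) ^+ s0 * (e1 * expR (- (lam * \sum_(i in S0) `|b i|))) by ring.
rewrite [lik X y b0 * expR _ * _]mulrAC -[X in X <= _]mulrA; apply: ler_wpM2l.
  by rewrite mulr_ge0 ?exprn_ge0 ?divr_ge0 ?(ltW lam0) ?(ltW (lik_gt0 _ _ _)).
rewrite -!expRD ler_expR; lra.
Qed.

(** Only the slice of [supp b0] is kept. The bound of [evidence_box] is constant on the box, whose
    volume [(2 * eta) ^+ s0] cancels the Laplace normalisation [(lam / 2) ^+ s0]. *)
Lemma evidence_lower y : (forall j, `|score X b0 y j| <= lambar X) ->
  ((evidence_const p pi s0 (2 * Num.sqrt L + 2)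
     * expR (- (lam * \sum_(i < p) `|b0 i|)) * lik X y b0)%:E
   <= prior_int pi lam (lik X y))%E.
Proof.
move=> good; set K := lik X y b0 * expR (- (lam * \sum_(i < p) `|b0 i|)) * (lam / 2) ^+ s0
    * expR (- (2 * Num.sqrt L + 2)).
have K0 : 0 <= K.
  by rewrite !mulr_ge0 ?exprn_ge0 ?divr_ge0 ?expR_ge0 ?(ltW lam0) ?(ltW (lik_gt0 _ _ _)).
set eta := (lam * (p%:R * s0%:R))^-1.
pose box (i : 'I_p) (x : R) : R := \1_(`[b0 i - eta, b0 i + eta]%classic) x.
have box0 i x : 0 <= box i x by rewrite /box indicE.
have box1 i x : box i x <= 1 by rewrite /box indicE lern1 leq_b1.
have mbox i : measurable_fun setT (box i : measurableTypeR R -> measurableTypeR R).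
  by apply: measurable_indic; exact: measurable_itv.
(* For an empty support [eta] is the inverse of zero, hence zero; positivity is claimed only for
   indices in the support, and the empty product keeps the volume equal to one. *)
have eta0 i : i \in S0 -> 0 < eta.
  by move=> iS; rewrite invr_gt0 !mulr_gt0 ?ltr0n//; apply/card_gt0P; exists i.
have Ibox : int_RS S0 (fun b => (K * \prod_(i in S0) box i (b i))%:E)
    = (K * (2 * eta) ^+ s0)%:E.
  transitivity (int_RS S0 (fun b => K%:E * (\prod_(i <- enum S0) box i (b i))%:E))%E.
    by apply: int_RS_eq => b _; rewrite big_enum EFinM.
  rewrite /int_RS iintZl//; last 2 first.
    by move=> b; rewrite lee_fin prodr_ge0.
    exact: meas_prod.
  rewrite [in RHS]EFinM; congr (_ * _)%E.
  rewrite (@iint_prod _ _ _ box (fun=> 2 * eta)) ?enum_uniq//.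
    by rewrite big_enum/= prodr_const.
  move=> i; rewrite mem_enum => /eta0 e0.
  rewrite integral_indic//= setIT lebesgue_measure_itv/= lte_fin ifT; last by lra.
  by rewrite -EFinB; congr EFin; lra.
rewrite /prior_int (bigD1 S0)//=.
apply: (@le_trans _ _ ((pi s0 / 'C(p, s0)%:R)%:E *
   int_RS S0 (fun b => (K * \prod_(i in S0) box i (b i))%:E))%E).
  rewrite Ibox -EFinM lee_fin /evidence_const /K.
  have -> : (2 * eta) ^+ s0 = (lam / 2) ^- s0 * ((p%:R * s0%:R) ^+ s0)^-1.
    rewrite -!exprVn -exprMn; congr (_ ^+ _); rewrite /eta invfM mulrA invf_div.
    by [].
  have l2 : (lam / 2) ^+ s0 != 0 by rewrite expf_neq0// gt_eqF ?divr_gt0.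
  rewrite le_eqVlt; apply/orP; left; apply/eqP.
  move: (pi s0 / _) ((p%:R * s0%:R) ^- s0) ((lam / 2) ^+ s0) l2 => w I P l2; field; exact: l2.
apply: (@le_trans _ _ ((pi s0 / 'C(p, s0)%:R)%:E *
   int_RS S0 (fun b => (lik X y b * \prod_(i in S0) laplace lam (b i))%:E))%E).
  apply: lee_wpmul2l; first by rewrite lee_fin prior_weight_ge0.
  apply: int_RS_le => b bS.
    by rewrite lee_fin mulr_ge0// prodr_ge0.
  rewrite lee_fin.
  have [H|H] := pselect (forall i, i \in S0 -> `|b i - b0 i| <= eta).
    apply: le_trans (evidence_box good bS H); rewrite ler_piMr// prodr_ile1//.
    by move=> i _; rewrite box0 box1.
  rewrite (_ : \prod_(i in S0) box i (b i) = 0).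
    by rewrite mulr0 mulr_ge0 ?(ltW (lik_gt0 _ _ _))// prodr_ge0// => i _; apply/laplace_ge0/ltW.
  have [i [iS bi]] : exists i, i \in S0 /\ ~ (`|b i - b0 i| <= eta).
    apply: contrapT => Hn; apply: H => i iS; apply: contrapT => bi; apply: Hn; by exists i.
  rewrite (bigD1 i)//= /box indicE memNset ?mul0r// => /=.
  rewrite in_itv/= => /andP[h1 h2]; apply: bi; rewrite ler_norml; lra.
rewrite leeDl// sume_ge0// => S _; apply: mule_ge0.
  by rewrite lee_fin prior_weight_ge0.
apply: int_RS_ge0 => b _; rewrite lee_fin mulr_ge0 ?(ltW (lik_gt0 _ _ _))//.
by rewrite prodr_ge0// => i _; apply/laplace_ge0/ltW.
Qed.

End Evidence.

(** * Posterior on the good event *)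

Section Measurability.
Variables (R : realType) (n p : nat) (X : 'M[R]_(n, p)).
Variables (d : measure_display) (T : measurableType d).

Lemma coord_measurable_mulXb (h : T -> 'I_p -> R) :
  coord_measurable h -> coord_measurable (fun t => mulXb X (h t)).
Proof.
move=> mh i; apply: measurable_sum => j; apply: measurable_funM => //; exact: mh.
Qed.

Lemma coord_measurableB k (g h : T -> 'I_k -> R) :
  coord_measurable g -> coord_measurable h ->
  coord_measurable (fun t i => g t i - h t i).
Proof. by move=> mg mh i; apply: measurable_funB; [exact: mg|exact: mh]. Qed.

Lemma measurable_sqnorm k (h : T -> 'I_k -> R) :
  coord_measurable h -> measurable_fun setT (fun t => sqnorm (h t)).
Proof. by move=> mh; apply: measurable_sum => i; apply: measurable_funX; exact: mh. Qed.

Lemma measurable_dot k (g h : T -> 'I_k -> R) :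
  coord_measurable g -> coord_measurable h ->
  measurable_fun setT (fun t => \sum_(i < k) g t i * h t i).
Proof.
by move=> mg mh; apply: measurable_sum => i; apply: measurable_funM; [exact: mg|exact: mh].
Qed.

Lemma measurable_l1 k (h : T -> 'I_k -> R) :
  coord_measurable h -> measurable_fun setT (fun t => \sum_(i < k) `|h t i|).
Proof.
by move=> mh; apply: measurable_sum => i; apply: measurableT_comp => //; exact: mh.
Qed.

Lemma measurable_gauss_dens b0 (g : T -> 'I_n -> R) : coord_measurable g ->
  measurable_fun setT (fun t => gauss_dens X b0 (g t)).
Proof.
move=> mg; apply: measurable_funM => //; apply: measurableT_comp => //.
apply: measurableT_comp => //; apply: measurable_funM => //.
apply: (@measurable_sqnorm n (fun t i => g t i - mulXb X b0 i)).
by apply: (coord_measurableB (h := fun=> mulXb X b0)) => //; exact: coord_measurable_cst.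
Qed.

Lemma measurable_prod_laplace lam (S : {set 'I_p}) (h : T -> 'I_p -> R) :
  coord_measurable h -> measurable_fun setT (fun t => \prod_(i in S) laplace lam (h t i)).
Proof.
move=> mh; under eq_fun do rewrite -big_enum /=.
apply: measurable_prod => i _; apply: measurable_funM => //.
apply: measurableT_comp => //; apply: measurableT_comp => //.
by apply: measurable_funM => //; apply: measurableT_comp => //; exact: mh.
Qed.

End Measurability.

(** * Domination of the posterior on the good event by jointly measurable kernels *)

Section PosteriorBound.
Variables (R : realType) (n p : nat) (X : 'M[R]_(n, p)).
Variables (pi : nat -> R) (lam : R) (b0 : 'I_p -> R) (thr : R).
Hypotheses (p0 : (0 < p)%N) (pi0 : forall s, (s <= p)%N -> 0 <= pi s).
Hypothesis (pis0 : 0 < pi #|supp b0|).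
Hypotheses (lam0 : 0 < lam) (lamX : colnorm X / p%:R <= lam).
Hypotheses (X0 : 0 < colnorm X) (lb0 : 0 < lambar X) (lamlb : lam <= 2 * lambar X).
Local Notation L := (ln (p%:R : R)).
Local Notation s0 := #|supp b0|.
Local Notation lb := (lambar X).
Local Notation a := (lam / (2 * lambar X)).
Local Notation c := (evidence_const p pi #|supp b0| (2 * Num.sqrt (ln p%:R) + 2)).
Local Notation B := (@dim_event R p thr%:E).

(* Obtained from the joint density of [(y, b)] by replacing a fraction
   [lam / (2 lb)] of the score term by its bound on the good event. *)
Definition slice_kernel (S : {set 'I_p}) (y : 'I_n -> R) (b : 'I_p -> R) : R :=
  let d i := b i - b0 i in
  expR (lam * (\sum_(i < p) `|b0 i|) + lam / 2 * (\sum_(i < p) `|d i|)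
    - sqnorm (mulXb X d) / 2) * (\prod_(i in S) laplace lam (b i)) *
  (expR (\sum_(i < n) ((1 - a) * mulXb X d i) * (y i - mulXb X b0 i)) * gauss_dens X b0 y).

(** The test is on the dimension of the slice, not on the support of the point, which may be
    smaller: the event is enlarged to whole slices and disappears from the integrand. *)
Definition slice_weight (S : {set 'I_p}) : R :=
  if thr < #|S|%:R then pi #|S| / 'C(p, #|S|)%:R / c else 0.

Lemma c_gt0 : 0 < c.
Proof. by apply: evidence_const_gt0 => //; exact: card_le_p. Qed.

Lemma slice_weight_ge0 S : 0 <= slice_weight S.
Proof.
rewrite /slice_weight; case: ifP => // _.
by rewrite divr_ge0 ?prior_weight_ge0// ltW// c_gt0.
Qed.

Lemma slice_kernel_ge0 S y b : 0 <= slice_kernel S y b.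
Proof.
rewrite /slice_kernel !mulr_ge0 ?expR_ge0 ?gauss_dens_ge0//.
  by rewrite prodr_ge0// => i _; apply/laplace_ge0/ltW.
by rewrite powR_ge0.
Qed.

Lemma jmeas_slice_kernel S : jmeas (fun y b => (slice_kernel S y b)%:E).
Proof.
move=> d T g h mg mh; apply/measurable_EFinP.
have md : coord_measurable (fun t i => h t i - b0 i).
  by apply: (coord_measurableB (h := fun=> b0)) => //; exact: coord_measurable_cst.
have mX := coord_measurable_mulXb X md.
apply: measurable_funM; last apply: measurable_funM.
- apply: measurable_funM; last exact: measurable_prod_laplace.
  apply: measurableT_comp => //; apply: measurable_funB.
    apply: measurable_funD => //; apply: measurable_funM => //.
    exact: (measurable_l1 md).
  apply: measurable_funM => //; exact: (measurable_sqnorm mX).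
- apply: measurableT_comp => //.
  apply: (@measurable_dot _ _ _ _ (fun t i => (1 - a) * mulXb X (fun j => h t j - b0 j) i)
    (fun t i => g t i - mulXb X b0 i)).
    by move=> i; apply: measurable_funM => //; exact: mX.
  by apply: (coord_measurableB (h := fun=> mulXb X b0)) => //; exact: coord_measurable_cst.
- exact: measurable_gauss_dens.
Qed.

Lemma meas_lik_laplace (S : {set 'I_p}) y :
  meas (fun b => (lik X y b * \prod_(i in S) laplace lam (b i))%:E).
Proof.
move=> d T h mh; apply/measurable_EFinP; apply: measurable_funM; last exact: measurable_prod_laplace.
apply: measurableT_comp => //; apply: measurableT_comp => //; apply: measurable_funM => //.
apply: (@measurable_sqnorm _ _ _ _ (fun t i => y i - mulXb X (h t) i)).
apply: (coord_measurableB (g := fun=> y)); first exact: coord_measurable_cst.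
exact: coord_measurable_mulXb.
Qed.

Lemma supp_card_le (S : {set 'I_p}) (b : 'I_p -> R) : supported S b -> (#|supp b| <= #|S|)%N.
Proof.
move=> bS; apply: subset_leq_card; apply/fintype.subsetP => i; rewrite inE.
by apply: contraNT => /bS ->; rewrite eqxx.
Qed.

Lemma numerator_le y :
  (prior_int pi lam (fun b => if B b then lik X y b else 0%R) <=
   \sum_(S : {set 'I_p}) (if (thr < #|S|%:R)%R then (pi #|S| / 'C(p, #|S|)%:R)%R else 0%R)%:E *
     int_RS S (fun b => (lik X y b * \prod_(i in S) laplace lam (b i))%:E))%E.
Proof.
have lap0 (S : {set 'I_p}) (b : 'I_p -> R) : 0 <= \prod_(i in S) laplace lam (b i).
  by rewrite prodr_ge0// => i _; apply/laplace_ge0/ltW.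
apply: lee_sum => S _; case: ifPn => [tS|tS].
  apply: lee_wpmul2l; first by rewrite lee_fin prior_weight_ge0.
  apply: int_RS_le => b _; rewrite lee_fin.
    by rewrite mulr_ge0//; case: ifP => // _; exact/ltW/lik_gt0.
  by apply: ler_wpM2r => //; case: ifP => // _; exact/ltW/lik_gt0.
rewrite (@int_RS_eq R p S _ (fun=> 0%E)) ?int_RS0 ?mule0 ?mul0e// => b bS.
rewrite /dim_event lte_fin ifF ?mul0r//; apply/negP => h; case/negP: tS.
by apply: lt_le_trans h _; rewrite ler_nat; exact: supp_card_le.
Qed.

(** The denominator is replaced by the lower bound [D], whose factor [lik X y b0] cancels against
    the likelihood ratio. Of the score term, the fraction [a] is bounded on the good event; the
    fraction [1 - a] is left intact, to be averaged exactly over the data. *)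
Lemma posterior_good y : (forall j, `|score X b0 y j| <= lb) ->
  ((posterior X pi lam B y * gauss_dens X b0 y)%:E <=
   \sum_(S : {set 'I_p}) (slice_weight S)%:E * int_RS S (fun b => (slice_kernel S y b)%:E))%E.
Proof.
move=> good; have c0 := c_gt0.
have lap0 (S : {set 'I_p}) (b : 'I_p -> R) : 0 <= \prod_(i in S) laplace lam (b i).
  by rewrite prodr_ge0// => i _; apply/laplace_ge0/ltW.
have g0 := gauss_dens_ge0 X b0 y; set g := gauss_dens X b0 y in g0 *.
have lik0 := lik_gt0 X y b0.
set D := c * expR (- (lam * \sum_(i < p) `|b0 i|)) * lik X y b0.
have D0 : 0 < D by apply: mulr_gt0 => //; apply: mulr_gt0 => //; exact: expR_gt0.
have := evidence_lower p0 pi0 lam0 lamX good; rewrite -/D => DD.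
rewrite /posterior; have := numerator_le y.
set N := prior_int _ _ (fun b => if _ then _ else _); set E := prior_int _ _ _ in DD *.
move=> NU.
have N0 : (0 <= N)%E.
  by apply: prior_int_ge0 => // [|b]; [exact: ltW|case: ifP => // _; exact/ltW/lik_gt0].
have NE : (N <= E)%E.
  apply: prior_int_le => // [|b|b]; first exact: ltW.
    by case: ifP => // _; exact/ltW/lik_gt0.
  by case: ifP => // _; exact/ltW/lik_gt0.
have Eoo : (E < +oo)%E.
  by apply: prior_int_fin => // b; rewrite lik_le1 ltW ?lik_gt0.
have Efin : E \is a fin_num by rewrite ge0_fin_numE// (le_trans N0).
have Nfin : N \is a fin_num by rewrite ge0_fin_numE// (le_lt_trans NE).
have DE : D <= fine E by rewrite -lee_fin fineK.
apply: (@le_trans _ _ ((g / D)%:E * N)%E).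
  rewrite -[in leRHS](fineK Nfin) -EFinM lee_fin.
  have -> : g / D * fine N = (fine N / D) * g by rewrite mulrAC [RHS]mulrAC [g * _]mulrC.
  apply: ler_wpM2r => //; apply: ler_wpM2l; first exact: fine_ge0.
  rewrite lef_pV2 ?posrE//.
  exact: lt_le_trans DE.
apply: le_trans (lee_wpmul2l _ NU) _; first by rewrite lee_fin divr_ge0// ltW.
rewrite ge0_sume_distrr; last first.
  move=> S _; apply: mule_ge0.
    by rewrite lee_fin; case: ifP => // _; exact: prior_weight_ge0.
  by apply: int_RS_ge0 => b _; rewrite lee_fin mulr_ge0// ltW// lik_gt0.
apply: lee_sum => S _; rewrite /slice_weight; case: ifP => _; last by rewrite !mul0e mule0.
set w := pi _ / _; rewrite muleA -EFinM.
have -> : g / D * w = w / c * (g * c / D).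
  by rewrite /D; field; rewrite !gt_eqF ?expR_gt0.
rewrite EFinM -muleA; apply: lee_wpmul2l.
  by rewrite lee_fin divr_ge0 ?prior_weight_ge0// ltW.
have gcD : 0 <= g * c / D := divr_ge0 (mulr_ge0 g0 (ltW c0)) (ltW D0).
rewrite /int_RS -iintZl//; last 2 first.
- by move=> b; rewrite lee_fin mulr_ge0// ltW// lik_gt0.
- exact: meas_lik_laplace.
apply: int_RS_le => b bS.
  by rewrite -EFinM lee_fin; apply: mulr_ge0 => //; apply: mulr_ge0 => //; exact/ltW/lik_gt0.
rewrite -EFinM lee_fin /slice_kernel -/g.
pose d i := b i - b0 i; rewrite -/d.
set P := \prod_(i in S) _; rewrite (lik_ratio X y b b0) -/d.
have [_ T1] := ler_normlP _ _ (@score_dot_le _ _ _ X _ b0 y d good).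
set T := \sum_(i < n) _ in T1 *.
have -> : \sum_(i < n) (1 - a) * mulXb X d i * (y i - mulXb X b0 i) = (1 - a) * T.
  by rewrite /T mulr_sumr; apply: eq_bigr => i _; rewrite -mulrA.
have aT : a * T <= lam / 2 * \sum_(i < p) `|d i|.
  apply: le_trans (ler_wpM2l _ T1) _; first by rewrite divr_ge0 ?mulr_ge0// ltW.
  by rewrite le_eqVlt; apply/orP; left; apply/eqP; field; rewrite gt_eqF.
have -> : g * c / D * (lik X y b0 * expR (T - sqnorm (mulXb X d) / 2) * P) =
   (expR (lam * \sum_(i < p) `|b0 i|) * expR (T - sqnorm (mulXb X d) / 2)) * (P * g).
  by rewrite /D expRN; field; rewrite !gt_eqF ?expR_gt0.
set e1 := expR (_ + _ - _); set e2 := expR ((1 - a) * T).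
have -> : e1 * P * (e2 * g) = (e1 * e2) * (P * g) by ring.
apply: ler_wpM2r; first exact: mulr_ge0 (lap0 _ _) g0.
rewrite /e1 /e2 -!expRD ler_expR.
by rewrite mulrBl mul1r; lra.
Qed.

End PosteriorBound.

(** * Integration over the observations *)

Section ExpectedPosterior.
Variables (R : realType) (n p : nat) (X : 'M[R]_(n, p)).
Variables (pi : nat -> R) (lam : R) (b0 : 'I_p -> R) (thr kap : R).
Hypotheses (p0 : (0 < p)%N) (pi0 : forall s, (s <= p)%N -> 0 <= pi s).
Hypothesis (pis0 : 0 < pi #|supp b0|).
Hypotheses (lam0 : 0 < lam) (lamX : colnorm X / p%:R <= lam).
Hypotheses (X0 : 0 < colnorm X) (lb0 : 0 < lambar X) (lamlb : lam <= 2 * lambar X).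
Hypotheses (L0 : 0 <= ln (p%:R : R)) (kap0 : 0 <= kap).
Hypothesis (compatX : forall d, 7 * l1on (supp b0) d <= l1on (~: supp b0) d \/
  l1on (supp b0) d ^+ 2 * colnorm X ^+ 2 <= kap * sqnorm (mulXb X d) * #|supp b0|%:R).
Local Notation L := (ln (p%:R : R)).
Local Notation s0 := #|supp b0|.
Local Notation lb := (lambar X).
Local Notation a := (lam / (2 * lambar X)).
Local Notation Q := (49 / 4 * (kap * (lam / lambar X)) * #|supp b0|%:R * ln (p%:R : R)).
Local Notation B := (@dim_event R p thr%:E).

Lemma lambar_sqr : lb ^+ 2 = 4 * colnorm X ^+ 2 * L.
Proof. by rewrite /lambar !exprMn sqr_sqrtr//; ring. Qed.

Lemma meas_gauss_tilt (u : 'I_n -> R) :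
  meas (fun y => (expR (\sum_(i < n) u i * (y i - mulXb X b0 i)) * gauss_dens X b0 y)%:E).
Proof.
move=> d T g mg; apply/measurable_EFinP; apply: measurable_funM; last exact: measurable_gauss_dens.
apply: measurableT_comp => //.
apply: (@measurable_dot _ _ _ _ (fun=> u) (fun t i => g t i - mulXb X b0 i)).
  exact: coord_measurable_cst.
by apply: (coord_measurableB (h := fun=> mulXb X b0)) => //; exact: coord_measurable_cst.
Qed.

Lemma int_gauss_tilt (k : R) (u : 'I_n -> R) : 0 <= k ->
  int_Rk (fun y => (k * (expR (\sum_(i < n) u i * (y i - mulXb X b0 i))
    * gauss_dens X b0 y))%:E) = (k * expR (sqnorm u / 2))%:E.
Proof.
move=> k0; rewrite [RHS]EFinM -(gauss_mgf X b0) /int_Rk -iintZl//.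
  by move=> y; rewrite lee_fin mulr_ge0 ?expR_ge0 ?gauss_dens_ge0.
exact: meas_gauss_tilt.
Qed.

(** Averaging over the data turns the retained score into [(1 - a) ^+ 2 / 2] times $|Xd|_2^2$. The
    compatibility bound leaves a Laplace factor of rate [lam / 4] around [b0], and
    [lam / (lam / 4) = 4] per coordinate. *)
Lemma int_slice_kernel (S : {set 'I_p}) :
  (int_RS S (fun b => int_Rk (fun y => (slice_kernel X lam b0 S y b)%:E))
   <= (expR Q * 4 ^+ #|S|)%:E)%E.
Proof.
have lap0 (b : 'I_p -> R) : 0 <= \prod_(i in S) laplace lam (b i).
  by rewrite prodr_ge0// => i _; apply/laplace_ge0/ltW.
pose F (b : 'I_p -> R) := \prod_(i in S) (lam / 2 * expR (- (lam / 4 * `|b i - b0 i|))).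
have F0 b : 0 <= F b.
  by rewrite prodr_ge0// => i _; rewrite mulr_ge0 ?expR_ge0// divr_ge0// ltW.
have -> : (expR Q * 4 ^+ #|S|)%:E = int_RS S (fun b => (expR Q)%:E * (F b)%:E)%E.
  rewrite /int_RS iintZl ?expR_ge0//; last first.
  - move=> d T h mh; apply/measurable_EFinP; under eq_fun do rewrite /F -big_enum /=.
    apply: measurable_prod => i _; apply: measurable_funM => //.
    exact: measurableT_comp (measurable_expRNabs _ _) (mh i).
  have l4 : 0 < lam / 4 by rewrite divr_gt0.
  rewrite EFinM -[iint _ _ _]/(int_RS S (fun b => (F b)%:E)) (int_RS_laplace S b0 lam0 l4).
  by congr (_ * (_ ^+ _)%:E)%E; field; rewrite gt_eqF.
apply: int_RS_le => b bS.
  by apply: iint_ge0 => y _; rewrite lee_fin slice_kernel_ge0.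
rewrite /slice_kernel int_gauss_tilt; last by rewrite mulr_ge0 ?expR_ge0.
rewrite -EFinM lee_fin prod_laplace /F big_split /= prodr_const -expR_sum.
pose d i := b i - b0 i; rewrite -/d.
have -> : sqnorm (fun i => (1 - a) * mulXb X d i) = (1 - a) ^+ 2 * sqnorm (mulXb X d).
  by rewrite /sqnorm mulr_sumr; apply: eq_bigr => i _; rewrite exprMn.
set e1 := expR (_ + _ - _); set e2 := expR (- (lam * _)); set e3 := expR (_ / 2).
set e4 := expR (\sum_(i in S) _).
have -> : e1 * ((lam / 2) ^+ #|S| * e2) * e3 = (lam / 2) ^+ #|S| * (e1 * e2 * e3) by ring.
have -> : expR Q * ((lam / 2) ^+ #|S| * e4) = (lam / 2) ^+ #|S| * (expR Q * e4) by ring.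
apply: ler_wpM2l; first by rewrite exprn_ge0// divr_ge0// ltW.
rewrite /e1 /e2 /e3 /e4 -!expRD ler_expR sumrN -mulr_sumr.
have := compat_exponent_vec lam0 lb0 lambar_sqr L0 kap0 bS compatX; rewrite -/d.
have N0 := sqnorm_ge0 (mulXb X d).
move: (sqnorm (mulXb X d)) N0 => N N0.
have aE : lam / (4 * lb) = a / 2 by field; rewrite gt_eqF.
have a0 : 0 <= a by rewrite divr_ge0 ?mulr_ge0// ltW.
have a1 : a <= 1.
  rewrite ler_pdivrMr; last by rewrite mulr_gt0.
  by rewrite mul1r.
rewrite aE; move: a a0 a1 => al al0 al1.
(* This gives [(1 - al)^2 / 2 - 1/2 <= - al / 2], the quadratic coefficient required by
   [compat_exponent_vec]; it relies on [lam <= 2 * lambar X]. *)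
have : al * (1 - al) * N >= 0 by rewrite !mulr_ge0// subr_ge0.
move: (Q) (\sum_(i < p) _) (\sum_(i < p) _) (\sum_(i in S) _) (\sum_(i in S) _) => q x1 x2 x3 x4.
by nra.
Qed.

(** Chernoff majorant, times the density, of the event that the score of column [js.1] with sign
    [js.2] exceeds [lb]. The tilt [t] minimises $t^2 \|X\|^2/2 - t\bar\lambda$. *)
Definition tail_kernel (js : 'I_p * bool) (y : 'I_n -> R) : R :=
  let t := lb / colnorm X ^+ 2 in
  expR (- (t * lb)) *
  (expR (\sum_(i < n) (t * ((-1) ^+ js.2 * X i js.1)) * (y i - mulXb X b0 i))
    * gauss_dens X b0 y).

Lemma tail_kernel_ge0 js y : 0 <= tail_kernel js y.
Proof.
by apply: mulr_ge0 (expR_ge0 _) (mulr_ge0 (expR_ge0 _) (gauss_dens_ge0 _ _ _)).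
Qed.

(** The posterior is at most one, and the kernel of the offending column, with the sign of its
    score, is at least the density. *)
Lemma posterior_bad y j : lb < `|score X b0 y j| ->
  posterior X pi lam B y * gauss_dens X b0 y <= \sum_js tail_kernel js y.
Proof.
move=> bad; have g0 := gauss_dens_ge0 X b0 y.
have /andP[_ post1] := posterior_le1 X B y pi0 lam0.
apply: (@le_trans _ _ (gauss_dens X b0 y)); first by rewrite ler_piMl.
rewrite (bigD1 (j, score X b0 y j < 0))//=.
apply: (@le_trans _ _ (tail_kernel (j, score X b0 y j < 0) y)); last first.
  by rewrite lerDl sumr_ge0// => js _; exact: tail_kernel_ge0.
rewrite /tail_kernel /= mulrA ler_peMl// -expRD -[leLHS]expR0 ler_expR.
set t := lb / _; have t0 : 0 < t by rewrite divr_gt0// exprn_gt0.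
have -> : \sum_(i < n) t * ((-1) ^+ (score X b0 y j < 0)%R * X i j) * (y i - mulXb X b0 i)
   = t * `|score X b0 y j|.
  rewrite [in RHS]real_normrEsign ?num_real// /score mulr_sumr mulr_sumr.
  by apply: eq_bigr => i _; rewrite -!mulrA.
by rewrite addrC -mulrBr mulr_ge0 ?(ltW t0)// subr_ge0 ltW.
Qed.

(** Both [t * lb] and $t^2 \|X\|^2$ equal [4 * L], so the exponent is at most [- 4 * L + 2 * L]. *)
Lemma int_tail_kernel js : 
  (int_Rk (fun y => (tail_kernel js y)%:E) <= (expR (- (2 * L)))%:E)%E.
Proof.
rewrite /tail_kernel int_gauss_tilt ?expR_ge0// lee_fin -expRD ler_expR.
set t := lb / _; have t0 : 0 <= t by rewrite divr_ge0 ?exprn_ge0// ltW.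
have -> : sqnorm (fun i => t * ((-1) ^+ js.2 * X i js.1)) =
    t ^+ 2 * \sum_(i < n) X i js.1 ^+ 2.
  rewrite mulr_sumr; apply: eq_bigr => i _.
  by rewrite !exprMn sqrr_sign mul1r.
have h : t ^+ 2 * \sum_(i < n) X i js.1 ^+ 2 <= t ^+ 2 * colnorm X ^+ 2.
  by apply: ler_wpM2l; [exact: sqr_ge0|exact: sqnorm_col_le].
have t1 : t * lb = 4 * L.
  by rewrite /t mulrAC -expr2 lambar_sqr; field; rewrite gt_eqF.
have t2 : t ^+ 2 * colnorm X ^+ 2 = 4 * L.
  by rewrite -t1 /t; field; rewrite gt_eqF.
by rewrite t1; lra.
Qed.

Lemma expect_posterior_le :
  (expect X b0 (posterior X pi lam B) <=
   (2 * expR (- L) +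
    \sum_(S : {set 'I_p}) slice_weight pi b0 thr S * (expR Q * 4 ^+ #|S|))%:E)%E.
Proof.
pose K (S : {set 'I_p}) y := int_RS S (fun b => (slice_kernel X lam b0 S y b)%:E).
pose w S := slice_weight pi b0 thr S.
have w0 S : 0 <= w S by apply: slice_weight_ge0.
have K0 S y : (0 <= K S y)%E.
  by apply: int_RS_ge0 => b _; rewrite lee_fin slice_kernel_ge0.
have mK S : meas (K S).
  apply: (@jmeas_measr _ p n (fun b y => iint (enum S)
    (fun b => (slice_kernel X lam b0 S y b)%:E) b) (fun=> 0)).
  apply: (jmeas_swap (f := fun y b => iint (enum S)
    (fun b => (slice_kernel X lam b0 S y b)%:E) b)).
  apply: (@jmeas_iint _ n p (fun y b => (slice_kernel X lam b0 S y b)%:E)).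
    by move=> y b; rewrite lee_fin slice_kernel_ge0.
  exact: jmeas_slice_kernel.
have mT js : meas (fun y => (tail_kernel js y)%:E).
  move=> d T g mg; apply/measurable_EFinP; apply: measurable_funM => //.
  by apply/measurable_EFinP; exact: (@meas_gauss_tilt
    (fun i => lb / colnorm X ^+ 2 * ((-1) ^+ js.2 * X i js.1)) _ _ _ mg).
have mwK S : meas (fun y => (w S)%:E * K S y)%E.
  by move=> d T g mg; apply: measurable_funeM; exact: mK.
have wK0 S y : (0 <= (w S)%:E * K S y)%E by rewrite mule_ge0// lee_fin.
have T0 js y : (0 <= (tail_kernel js y)%:E)%E by rewrite lee_fin tail_kernel_ge0.
(* The sum of the two majorants dominates for every [y], so the good event itself is never
   integrated. *)
apply: (@le_trans _ _ (int_Rk (fun y => \sum_js (tail_kernel js y)%:E +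
    \sum_S (w S)%:E * K S y)%E)).
  apply: iint_le => y _.
    rewrite lee_fin mulr_ge0 ?gauss_dens_ge0//.
    by case/andP: (posterior_le1 X B y pi0 lam0).
  have [good|bad] := pselect (forall j, `|score X b0 y j| <= lb).
    apply: (@le_trans _ _ (\sum_S (w S)%:E * K S y)%E); first exact: posterior_good.
    by rewrite leeDr// sume_ge0.
  have [j bj] : exists j, lb < `|score X b0 y j|.
    apply: contrapT => H; apply: bad => j; rewrite leNgt; apply/negP => bj.
    by apply: H; exists j.
  rewrite -[leLHS]adde0; apply: leeD; last by rewrite sume_ge0.
  by rewrite sumEFin lee_fin; exact: posterior_bad bj.
rewrite /int_Rk iintD; last 4 first.
- by move=> y; rewrite sume_ge0.
- by move=> y; rewrite sume_ge0.
- by move=> d T g mg; apply: emeasurable_sum => js; exact: mT.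
- by move=> d T g mg; apply: emeasurable_sum => S; exact: mwK.
rewrite !iint_sum// EFinD; apply: leeD.
  apply: (@le_trans _ _ (\sum_(js : 'I_p * bool) (expR (- (2 * L)))%:E)%E).
    by apply: lee_sum => js _; exact: int_tail_kernel.
  (* There are [2 * p] kernels, and [p = expR L] turns [2 p expR (- (2 * L))] into
     [2 * expR (- L)]. *)
  rewrite sumEFin lee_fin sumr_const card_prod card_ord card_bool -[leLHS]mulr_natl natrM.
  have pE : p%:R = expR L by rewrite lnK// posrE ltr0n.
  rewrite {1}pE mulrAC -expRD mulrC le_eqVlt; apply/orP; left; apply/eqP.
  by congr (_ * expR _); ring.
rewrite -sumEFin; apply: lee_sum => S _; rewrite iintZl// EFinM.
apply: lee_wpmul2l; first by rewrite lee_fin.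
have := int_slice_kernel S; rewrite /int_RS /int_Rk.
rewrite -(@iint_swap _ n p (fun y b => (slice_kernel X lam b0 S y b)%:E))//.
  by move=> y b; rewrite lee_fin slice_kernel_ge0.
exact: jmeas_slice_kernel.
Qed.

End ExpectedPosterior.

(** * Conclusion *)

Section Conclusion.
Variable R : realType.

Lemma expect_null n p (X : 'M[R]_(n, p)) pi lam (B : pred ('I_p -> R)) b0 :
  (forall S b, supported S b -> B b -> \prod_(i in S) laplace lam (b i) = 0) ->
  expect X b0 (posterior X pi lam B) = 0%E.
Proof.
move=> H; rewrite /expect /int_Rk (@eq_iint _ _ _ _ (fun=> 0%E)) ?iint0// => y _.
by rewrite posterior_null// mul0r.
Qed.

Lemma threshold_ge0 (M A4 lam lb : R) s phi :
  0 <= M -> 0 <= A4 -> 0 <= lam -> 0 <= lb -> (0 <= threshold M A4 lam lb s phi)%E.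
Proof.
move=> M0 A0 l0 b0; case: phi => [r| |] /=.
- case: ifP => _; first by case: ifP.
  have q0 : 0 <= 16 / r ^+ 2 * (lam / lb).
    by apply: mulr_ge0; rewrite divr_ge0// sqr_ge0.
  by rewrite lee_fin addr_ge0// mulr_ge0// mulr_ge0 ?addr_ge0// divr_ge0.
- by rewrite lee_fin addr_ge0// mulr_ge0// divr_ge0.
- by rewrite lee_fin addr_ge0// mulr_ge0// divr_ge0.
Qed.

Lemma sum_slice_weight p (pi : nat -> R) (b0 : 'I_p -> R) (thr q : R) :
  \sum_(S : {set 'I_p}) slice_weight pi b0 thr S * (q * 4 ^+ #|S|) =
  \sum_(s < p.+1 | thr < s%:R) pi s * 4 ^+ s *
    (q / evidence_const p pi #|supp b0| (2 * Num.sqrt (ln p%:R) + 2)).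
Proof.
pose c := evidence_const p pi #|supp b0| (2 * Num.sqrt (ln p%:R) + 2).
rewrite [RHS]big_mkcond /= -/c.
rewrite -(sum_set_card p (fun s => if thr < s%:R then pi s * 4 ^+ s * (q / c) else 0)).
apply: eq_bigr => S _; rewrite /slice_weight -/c; case: ifP => _; last by rewrite !mul0r.
by ring.
Qed.

End Conclusion.

Theorem theorem1 (R : realType) (A1 A2 A3 A4 : R)
  (hA1 : 0 < A1) (hA2 : 0 < A2) (hA3 : 0 < A3) (hA4 : 0 < A4)
  (M : R) (hM : 2 < M) :
  forall eps : R, 0 < eps ->
  exists N : nat, forall n p : nat, (N <= n)%N -> (N <= p)%N ->
  forall (X : 'M[R]_(n, p)) (lam : R) (pi : nat -> R),
    is_prob_on p pi ->
    colnorm X / p%:R <= lam -> lam <= 2 * lambar X ->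
    (forall s : nat, (1 <= s <= p)%N ->
        A1 * powR (p%:R) (- A3) * pi s.-1 <= pi s /\
        pi s <= A2 * powR (p%:R) (- A4) * pi s.-1) ->
    forall beta0 : 'I_p -> R,
      (expect X beta0
         (posterior X pi lam
            (@dim_event _ p (threshold M A4 lam (lambar X) #|supp beta0|
                                    (compat X (supp beta0)))))
       <= eps%:E)%E.
Proof.
move=> eps eps0; have e20 : 0 < eps / 2 by rewrite divr_gt0.
have [B HB] := eventually_budget hA2 hA4 hM e20.
(* Chosen so that [p >= N] forces [ln p >= B]; it depends on neither the design, the prior nor
   [beta0]. *)
exists (Num.truncn (expR B)).+1 => n p _ Np X lam pi pi1 lamX lamlb Hpi b0.
have p0 : (0 < p)%N by exact: leq_trans Np.
have pp : 0 < p%:R :> R by rewrite ltr0n.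
have BL : B <= ln p%:R.
  rewrite -[leLHS]expRK ler_ln ?posrE ?expR_gt0//; apply: le_trans (ltW (truncnS_gt _)) _.
  by rewrite ler_nat.
have [L1 h8 h4 hb he] := HB _ BL.
have L0 : 0 <= ln p%:R :> R by apply: le_trans L1.
have M0 : 0 <= M by apply: le_trans (ltW hM).
have pi0 := pi1.1.
have X0 := colnorm_ge0 X.
have lam0 : 0 <= lam by apply: le_trans lamX; rewrite divr_ge0.
have lb0 : 0 <= lambar X by rewrite !mulr_ge0 ?sqrtr_ge0.
(* A zero design forces [lam = 0]. Points of the event have nonempty support, so their Laplace
   product contains a zero factor. *)
have [Xz|Xnz] := eqVneq (colnorm X) 0.
  have lamz : lam = 0.
    by apply/eqP; rewrite eq_le lam0 andbT; apply: le_trans lamlb _; rewrite /lambar Xz !mulr0 !mul0r !mulr0.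
  rewrite expect_null ?lee_fin ?ltW// => S b bS.
  rewrite /dim_event => hB; have : (0 < #|supp b|)%N.
    rewrite -(ltr_nat R) -lte_fin; apply: le_lt_trans hB.
    by apply: threshold_ge0 => //; exact: ltW.
  move=> /leq_trans/(_ (supp_card_le bS)) /card_gt0P[i iS].
  by rewrite (bigD1 i)//= /laplace lamz !mul0r.
have Xp : 0 < colnorm X by rewrite lt_neqAle eq_sym Xnz.
have lbp : 0 < lambar X.
  by rewrite !mulr_gt0// sqrtr_gt0; apply: lt_le_trans L1.
have lamp : 0 < lam by apply: lt_le_trans lamX; rewrite divr_gt0.
(* In the first case the threshold is [+oo] and the event is empty. *)
have [[S0 c0]|[kap [kap0 thrE Hcompat]]] := compat_cases (supp b0) Xp.
  rewrite expect_null ?lee_fin ?ltW// => S b _.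
  by rewrite /dim_event c0 /= eqxx cards_eq0 (negbTE S0).
rewrite thrE.
have pis0 : 0 < pi #|supp b0|.
  apply: (prior_gt0 _ _ pi1 Hpi (card_le_p _)); first by rewrite mulr_gt0 ?powR_gt0.
  by rewrite mulr_ge0 ?powR_ge0// ltW.
apply: le_trans (expect_posterior_le _ p0 pi0 pis0 lamp lamX Xp lbp lamlb L0 kap0 Hcompat) _.
(* Half of [eps] for the Chernoff term, half for the prior tail. *)
rewrite lee_fin sum_slice_weight [leRHS](splitr eps); apply: lerD => //.
apply: (prior_tail p0 (card_le_p _) pis0 _ e20 hA2 hA4 hM _ L0 h8 h4 hb).
  by rewrite mulr_ge0 ?divr_ge0.
by move=> s sp; case: (Hpi s sp).
Qed.
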